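(* For every $\epsilon\in(0,1)$ there exist constants $C_\epsilon>0$ and $N_\epsilon$ such that the following holds. Let $n\ge N_\epsilon$ and let $r$ be a positive integer with $r<n$ such that $\log^{(4r)}n$ is defined and positive. Let $\mu=\mu_1\times\cdots\times\mu_r$ be a probability measure on $(\{0,1\}^n)^r$ where each $\mu_i$ is a product probability measure on $\{0,1\}^n$, and let $f\colon(\{0,1\}^n)^r\to\{0,1\}$ be an $r$-round coin-flipping protocol. Then there exist a set $B\subseteq[n]$ with $|B|\le C_\epsilon\,\frac{n(\log^\star n)^2}{\log^{(4r)}n}$ and a value $b\in\{0,1\}$ such that $I^b_B(f)\ge 1-\epsilon$. (That is, $f$ is not $\epsilon$-resilient against coalitions of size $\omega_\epsilon\!\left(\frac{n(\log^\star n)^2}{\log^{(4r)}n}\right)$.)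
   Context: $\log^{(k)}n$ denotes the $k$-fold iterated logarithm of $n$ and $\log^\star n$ the iterated-logarithm function. A product probability measure on $\{0,1\}^n$ is one under which the coordinates are independent. An $r$-round coin-flipping protocol is a map $f\colon(\{0,1\}^n)^r\to\{0,1\}$, executed in $r$ rounds as follows in the presence of a coalition $B\subseteq[n]$ of bad players: in round $i$, the players in $[n]\setminus B$ choose $\alpha^i\in\{0,1\}^{[n]\setminus B}$ according to the restriction of $\mu_i$ to $[n]\setminus B$ (independently across rounds), and then the bad players choose their bits in round $i$ as a function of $\alpha^1,\dots,\alpha^i$. Formally, a strategy for $B$ is a sequence $\pi=(\pi_1,\dots,\pi_r)$ of functions $\pi_i\colon(\{0,1\}^{[n]\setminus B})^i\to\{0,1\}^B$, where $\pi_i$ gives the bits of the bad players in round $i$. The output is $f$ applied to the resulting $r$ broadcast strings. $I^b_{\pi,B}(f)$ is the probability that $f$ outputs $b$ when $B$ follows $\pi$, and $I^b_B(f)=\sup_\pi I^b_{\pi,B}(f)$. The protocol is $\epsilon$-resilient against coalitions of size $\ell$ if there is no $B$ with $|B|\le\ell$ and $b$ with $I^b_B(f)\ge1-\epsilon$. *)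

(* Defs.v *)
From mathcomp Require Import all_boot all_order all_algebra.
From mathcomp Require Import boolp classical_sets reals exp.

Set Implicit Arguments.
Unset Strict Implicit.
Unset Printing Implicit Defensive.

Import Order.TTheory GRing.Theory Num.Theory.

Local Open Scope ring_scope.
Local Open Scope classical_set_scope.

Section IteratedLogarithm.
Variable R : realType.

Definition log2 (x : R) : R := ln x / ln 2.

Definition ilog (k : nat) (x : R) : R := iter k log2 x.

(* ln is a total function, so the domain condition of the k-fold iterated
   logarithm has to be made explicit. *)
Definition ilog_defined (k : nat) (x : R) : Prop :=
  forall j : nat, (j < k)%N -> 0 < ilog j x.

Lemma log2_le (m : nat) (x : R) : x <= m.+2%:R -> log2 x <= m.+1%:R.
Proof.
have l2 : 0 < ln (2 : R) by apply: ln_gt0; rewrite ltr1n.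
move=> xm; rewrite /log2 ler_pdivrMr //.
have [x1|x1] := leP x 1.
  by apply: (le_trans (ln_le0 x1)); rewrite mulr_ge0 ?ler0n ?ltW.
have x0 : 0 < x := lt_trans ltr01 x1.
rewrite mulr_natl -lnXn ?ltr0n // ler_ln ?posrE ?exprn_gt0 ?ltr0n //.
by rewrite (le_trans xm) // -natrX ler_nat ltn_expl.
Qed.

Lemma ex_ilog_le1 (x : R) : exists k : nat, ilog k x <= 1.
Proof.
have [m xm] : exists m : nat, x <= m.+1%:R.
  by exists (Num.truncn x); rewrite ltW // truncnS_gt.
elim: m x xm => [|m IHm] x xm; first by exists 0%N.
have [k le1] := IHm _ (log2_le xm).
by exists k.+1; rewrite /ilog iterSr.
Qed.

Definition logstar (x : R) : nat := ex_minn (ex_ilog_le1 x).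

End IteratedLogarithm.

(* The cube {0,1}^I for a finite index type I. *)
Notation cube I := {ffun I -> bool}.

Section ProbabilityOnCube.
Variables (R : realType) (n : nat).

(* Measures on the finite set {0,1}^n are given by their mass functions. *)
Definition is_probability (mu : cube 'I_n -> R) : Prop :=
  (forall x, 0 <= mu x) /\ \sum_x mu x = 1.

(* The probability that the i-th coordinate equals c. *)
Definition coord_prob (mu : cube 'I_n -> R) (i : 'I_n) (c : bool) : R :=
  \sum_(x : cube 'I_n | x i == c) mu x.

Definition is_product_probability (mu : cube 'I_n -> R) : Prop :=
  is_probability mu /\
  forall x : cube 'I_n, mu x = \prod_(i < n) coord_prob mu i (x i).

End ProbabilityOnCube.

Section Protocol.
Variables (R : realType) (n r : nat).

Definition good_bits (B : {set 'I_n}) := cube {i : 'I_n | i \notin B}.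
Definition bad_bits (B : {set 'I_n}) := cube {i : 'I_n | i \in B}.

Definition restrict_good (B : {set 'I_n}) (x : cube 'I_n) : good_bits B :=
  [ffun i => x (val i)].

(* The restriction of mu to [n] \ B, i.e. its marginal on {0,1}^([n] \ B). *)
Definition restrict_measure (mu : cube 'I_n -> R) (B : {set 'I_n})
    (a : good_bits B) : R :=
  \sum_(x : cube 'I_n | restrict_good B x == a) mu x.

Definition glue (B : {set 'I_n}) (a : good_bits B) (c : bad_bits B) :
    cube 'I_n :=
  [ffun i => match boolP (i \in B) with
             | AltTrue iB => c (Sub i iB)
             | AltFalse iB => a (Sub i iB)
             end].

Definition protocol := {ffun 'I_r -> cube 'I_n} -> bool.

(* Rounds are numbered from 0, so round i is the (i+1)-st one, and the bits
   of the bad players in it depend on the i+1 strings broadcast so far by the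
   good players. *)
Definition strategy (B : {set 'I_n}) :=
  forall i : 'I_r, {ffun 'I_i.+1 -> good_bits B} -> bad_bits B.

Definition history (B : {set 'I_n}) (alpha : {ffun 'I_r -> good_bits B})
    (i : 'I_r) : {ffun 'I_i.+1 -> good_bits B} :=
  [ffun j => alpha (widen_ord (ltn_ord i) j)].

Definition transcript (B : {set 'I_n}) (strat : strategy B)
    (alpha : {ffun 'I_r -> good_bits B}) : {ffun 'I_r -> cube 'I_n} :=
  [ffun i => glue (alpha i) (strat i (history alpha i))].

Definition strategy_influence (mu : 'I_r -> cube 'I_n -> R) (f : protocol)
    (b : bool) (B : {set 'I_n}) (strat : strategy B) : R :=
  \sum_(alpha : {ffun 'I_r -> good_bits B} | f (transcript strat alpha) == b)
     \prod_(i < r) restrict_measure (mu i) (alpha i).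

Definition influence (mu : 'I_r -> cube 'I_n -> R) (f : protocol) (b : bool)
    (B : {set 'I_n}) : R :=
  sup (range (@strategy_influence mu f b B)).

End Protocol.

(* Main.v *)
Require Import Defs.
From mathcomp Require Import all_boot all_order all_algebra ring lra.
From mathcomp Require Import boolp classical_sets reals sequences exp.

Set Implicit Arguments.
Unset Strict Implicit.
Unset Printing Implicit Defensive.

Import Order.TTheory GRing.Theory Num.Theory.

Local Open Scope ring_scope.

(* Fix y = log^(4r) n and sample players independently and uniformly. The claim
   proved by induction on the number of rounds is that a sample of size O(n/y)
   per round controls the game with a probability sigma that depends on y but
   not on n. Given the first-round string x, a sample B controls the remaining
   game with probability at least sigma, so for many B the event that B can
   force the value b after x has measure at least sigma/4 for some b, and it
   remains to boost this event to measure 1 - e in a single round. By the mean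
   value principle, after a random number of sampled players have joined the
   coalition the expected total influence of the event is O(y^2). An event of
   bounded total influence is nearly determined by a bounded set of coordinates
   (Friedgut's junta theorem, here with the entropy argument of Falik and
   Samorodnitsky), and with probability bounded below the next sampled players
   contain this set. This costs two exponentials per round.

   Bits of small probability break the boosting step. They are removed
   beforehand: in each round a random set of players, of density 1/y, tosses
   fair coins, which amounts to playing against the mixture of each coordinate
   with a fair coin. *)

(** * Averaging over coordinates of the cube *)

Section ProductExpectation.
Variables (R : realType) (n : nat).
Implicit Types (p q : 'I_n -> bool -> R) (f g : cube 'I_n -> R).
Implicit Types (x y : cube 'I_n) (i j : 'I_n) (s : seq 'I_n).

Definition upd x i (c : bool) : cube 'I_n :=
  [ffun j => if j == i then c else x j].

Definition coord_dist p : Prop :=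
  forall i, (forall c, 0 <= p i c) /\ p i true + p i false = 1.

Definition ex p f : R := \sum_(x : cube 'I_n) (\prod_i p i (x i)) * f x.

Definition av p i f x : R :=
  p i true * f (upd x i true) + p i false * f (upd x i false).

Definition dd i f x : R := f (upd x i true) - f (upd x i false).

Definition avs p s f := foldl (fun h i => av p i h) f s.

Definition free_of i f := forall x c, f (upd x i c) = f x.

Lemma upd_same x i c c' : upd (upd x i c) i c' = upd x i c'.
Proof. by apply/ffunP=> j; rewrite !ffunE; case: eqP. Qed.

Lemma updC x i j c c' : i != j ->
  upd (upd x i c) j c' = upd (upd x j c') i c.
Proof.
move=> ij; apply/ffunP=> k; rewrite !ffunE.
by case: eqP => // ->; rewrite eq_sym (negPf ij).
Qed.

Lemma upd_id x i : upd x i (x i) = x.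
Proof. by apply/ffunP=> j; rewrite !ffunE; case: eqP => // ->. Qed.

Lemma upd_at x i c : upd x i c i = c.
Proof. by rewrite ffunE eqxx. Qed.

Lemma eq_ex p f g : f =1 g -> ex p f = ex p g.
Proof. by move=> fg; apply: eq_bigr => x _; rewrite fg. Qed.

Lemma exD p f g : ex p (fun x => f x + g x) = ex p f + ex p g.
Proof. by rewrite -big_split; apply: eq_bigr => x _; rewrite mulrDr. Qed.

Lemma exN p f : ex p (fun x => - f x) = - ex p f.
Proof. by rewrite -sumrN; apply: eq_bigr => x _; rewrite mulrN. Qed.

Lemma exB p f g : ex p (fun x => f x - g x) = ex p f - ex p g.
Proof. by rewrite exD exN. Qed.

Lemma exZ p a f : ex p (fun x => a * f x) = a * ex p f.
Proof. by rewrite mulr_sumr; apply: eq_bigr => x _; rewrite mulrCA. Qed.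

Lemma ex_sum p (J : finType) (P : pred J) (F : J -> cube 'I_n -> R) :
  ex p (fun x => \sum_(j | P j) F j x) = \sum_(j | P j) ex p (F j).
Proof.
by rewrite /ex exchange_big; apply: eq_bigr => x _; rewrite mulr_sumr.
Qed.

Section FixedDistribution.
Variables (p : 'I_n -> bool -> R).
Hypothesis pP : coord_dist p.

Lemma coord_dist_ge0 i c : 0 <= p i c. Proof. by case: (pP i). Qed.

Lemma coord_dist1 i : p i true + p i false = 1. Proof. by case: (pP i). Qed.

Lemma coord_dist_le1 i c : p i c <= 1.
Proof.
by rewrite -(coord_dist1 i); case: c; rewrite ?lerDl ?lerDr coord_dist_ge0.
Qed.

Lemma ex_le f g : (forall x, f x <= g x) -> ex p f <= ex p g.
Proof.
move=> fg; apply: ler_sum => x _; apply: ler_wpM2l (fg x).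
by apply: prodr_ge0 => i _; apply: coord_dist_ge0.
Qed.

Lemma ex_cst a : ex p (fun=> a) = a.
Proof.
rewrite /ex -mulr_suml.
have -> : \sum_(x : cube 'I_n) \prod_i p i (x i) = 1.
  rewrite -(bigA_distr_bigA (fun i c => p i c)) big1 // => i _.
  by rewrite big_bool; exact: coord_dist1.
by rewrite mul1r.
Qed.

Lemma ex_ge0 f : (forall x, 0 <= f x) -> 0 <= ex p f.
Proof. by move=> f0; rewrite -(ex_cst 0); apply: ex_le. Qed.

Definition flip i x := upd x i (~~ x i).

Lemma flipK i : involutive (flip i).
Proof.
by move=> x; rewrite /flip upd_same upd_at negbK upd_id.
Qed.

Lemma sum_upd i (F : cube 'I_n -> R) :
  (\sum_x F x) *+ 2 = \sum_x (F (upd x i true) + F (upd x i false)).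
Proof.
rewrite mulr2n {2}(reindex_inj (can_inj (flipK i))) -big_split /=.
apply: eq_bigr => x _; rewrite /flip -{1}(upd_id x i).
by case: (x i) => //; rewrite addrC.
Qed.


Lemma prod_upd x i c : \prod_j p j (upd x i c j) =
  p i c * \prod_(j | j != i) p j (x j).
Proof.
rewrite (bigD1 i) //= upd_at; congr (_ * _).
by apply: eq_bigr => j /negPf ji; rewrite ffunE ji.
Qed.

Lemma ex_av i f : ex p (av p i f) = ex p f.
Proof.
apply: (mulIf (_ : 2%:R != 0)); first by rewrite pnatr_eq0.
rewrite !mulr_natr !(sum_upd i); apply: eq_bigr => x _.
rewrite !prod_upd /av !upd_same.
set w := \prod_(_ | _) _; have := coord_dist1 i.
by move=> e; rewrite -!mulrA -mulrDl e mul1r; ring.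
Qed.

Lemma av_le i f g : (forall x, f x <= g x) -> forall x, av p i f x <= av p i g
  x.
Proof. by move=> fg x; rewrite lerD // ler_wpM2l ?coord_dist_ge0. Qed.

Lemma avs_le s f g : (forall x, f x <= g x) ->
  forall x, avs p s f x <= avs p s g x.
Proof.
by elim: s f g => //= i s IH f g fg; apply/IH/av_le.
Qed.

Lemma ex_avs s f : ex p (avs p s f) = ex p f.
Proof. by elim: s f => //= i s IH f; rewrite IH ex_av. Qed.

Lemma free_av i f : free_of i (av p i f).
Proof. by move=> x c; rewrite /av !upd_same. Qed.

Lemma free_of_av i j f : free_of i f -> free_of i (av p j f).
Proof.
move=> fi; have [->|ij] := eqVneq i j; first exact: free_av.
by move=> x c; rewrite /av !(updC _ _ _ ij) !fi.
Qed.

Lemma free_of_avs i s f : free_of i f -> free_of i (avs p s f).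
Proof. by elim: s f => //= j s IH f fi; apply/IH/free_of_av. Qed.

Lemma free_avs i s f : i \in s -> free_of i (avs p s f).
Proof.
elim: s f => //= j s IH f; rewrite in_cons => /orP[/eqP <-|/IH]; last exact.
exact/free_of_avs/free_av.
Qed.

Lemma free_cst f : (forall i, free_of i f) -> forall x y, f x = f y.
Proof.
move=> fr x y.
have -> : y = foldr (fun i z => upd z i (y i)) x (enum 'I_n).
  apply/ffunP=> i.
  have : i \in enum 'I_n by rewrite mem_enum.
  elim: (enum 'I_n) => //= j s IH; rewrite in_cons ffunE.
  by case: eqP => [->|_].
by elim: (enum 'I_n) => //= i s ->; rewrite fr.
Qed.

Lemma ex_free_avs s f x : (forall i, i \notin s -> free_of i f) ->
  ex p f = avs p s f x.
Proof.
move=> fr; rewrite -(ex_avs s) -[RHS]ex_cst; apply: eq_ex => y.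
apply: free_cst => i; have [/free_avs|/fr/free_of_avs] := boolP (i \in s).
  exact.
exact.
Qed.

Lemma ex_sqr_sub_av i f :
  ex p (fun x => (f x - av p i f x) ^+ 2) =
  ex p (fun x => f x ^+ 2) - ex p (fun x => av p i f x ^+ 2).
Proof.
rewrite -exB -(ex_av i) -[RHS](ex_av i); apply: eq_ex => x.
rewrite /av !upd_same.
move: (f (upd x i true)) (f (upd x i false)) => a b.
have -> : p i false = 1 - p i true by rewrite -(coord_dist1 i); ring.
ring.
Qed.

Lemma dd_sub i f g x : dd i (fun y => f y - g y) x = dd i f x - dd i g x.
Proof. by rewrite /dd; ring. Qed.

Lemma dd_av i j f : i != j -> dd i (av p j f) =1 av p j (dd i f).
Proof.
move=> ij x; rewrite /dd /av !(updC x true _ ij) !(updC x false _ ij); ring.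
Qed.

Lemma dd_free i f x : free_of i f -> dd i f x = 0.
Proof. by move=> fi; rewrite /dd !fi subrr. Qed.

Lemma ex_dd_sub_av i j f :
  ex p (fun x => dd i (fun y => f y - av p j f y) x ^+ 2) =
  ex p (fun x => dd i f x ^+ 2) - ex p (fun x => dd i (av p j f) x ^+ 2).
Proof.
have [->|ij] := eqVneq i j.
  rewrite -exB; apply: eq_ex => x; rewrite dd_sub.
  by rewrite (dd_free _ (free_av _ f)) subr0 expr0n subr0.
have e : dd i (av p j f) =1 av p j (dd i f) by exact: dd_av.
under eq_ex => x do rewrite dd_sub e.
rewrite ex_sqr_sub_av; congr (_ - _).
by apply: eq_ex => x; rewrite e.
Qed.

Lemma normr_av i f x : `|av p i f x| <= av p i (fun y => `|f y|) x.
Proof.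
apply: (le_trans (ler_normD _ _)); rewrite !normrM.
by rewrite !(ger0_norm (coord_dist_ge0 _ _)).
Qed.

Lemma ex_norm_dd_av i j f :
  ex p (fun x => `|dd i (av p j f) x|) <= ex p (fun x => `|dd i f x|).
Proof.
have [->|ij] := eqVneq i j.
  apply: ex_le => x; rewrite (dd_free _ (free_av _ f)) normr0; exact: normr_ge0.
rewrite -[leRHS](ex_av j); apply: ex_le => x.
by rewrite dd_av //; apply: normr_av.
Qed.

Lemma ex_norm_sub_av i f :
  ex p (fun x => `|f x - av p i f x|) <= ex p (fun x => `|dd i f x|).
Proof.
apply: ex_le => x; rewrite -{1}(upd_id x i) /av /dd.
have pf : p i false = 1 - p i true by rewrite -(coord_dist1 i); ring.
set a := f (upd x i true); set b := f (upd x i false).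
have [t0 t1] := (coord_dist_ge0 i true, coord_dist_le1 i true).
have [f0 f1] := (coord_dist_ge0 i false, coord_dist_le1 i false).
case: (x i); rewrite -/a -/b.
  rewrite (_ : _ - _ = p i false * (a - b)); last by rewrite pf; ring.
  by rewrite normrM ger0_norm // ler_piMl.
rewrite (_ : _ - _ = - (p i true * (a - b))); last by rewrite pf; ring.
by rewrite normrN normrM ger0_norm // ler_piMl.
Qed.

End FixedDistribution.
End ProductExpectation.

(** * A logarithmic Sobolev inequality for arbitrary biases *)

Section LogSobolev.
Variable R : realType.

Lemma ln_le_sub1 (z : R) : 0 < z -> ln z <= z - 1.
Proof.
move=> z0; rewrite [X in ln X](_ : z = 1 + (z - 1)); last by ring.
by apply: le_ln1Dx; lra.
Qed.

Lemma gibbs_term (w al u ub M : R) : 0 <= w -> 0 <= al -> 0 < u -> 0 < ub ->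
  0 < M ->
  w * al * (ln u - ln ub) <= w * (u * M / ub) + w * (al ^+ 2 / M) - 2 * (w *
    al).
Proof.
move=> w0 al0 u0 ub0 M0.
have [->|al1] := eqVneq al 0.
  rewrite !(mulr0, mul0r) expr0n /= mul0r mulr0 subr0 addr0.
  by rewrite !mulr_ge0 // ?invr_ge0 ltW.
have {al0 al1} al0 : 0 < al by rewrite lt_neqAle eq_sym al1.
have -> : ln u - ln ub = ln (u * M / (ub * al)) + ln (al / M).
  rewrite !(lnM, lnV) ?posrE ?invr_gt0 ?mulr_gt0 ?invr_gt0 ?mulr_gt0 //; ring.
have h1 : ln (u * M / (ub * al)) <= u * M / (ub * al) - 1.
  by apply: ln_le_sub1; rewrite !mulr_gt0 ?invr_gt0 ?mulr_gt0.
have h2 : ln (al / M) <= al / M - 1.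
  by apply: ln_le_sub1; rewrite mulr_gt0 ?invr_gt0.
have wa : 0 <= w * al by rewrite mulr_ge0 // ltW.
apply: (le_trans (ler_wpM2l wa (lerD h1 h2))).
rewrite le_eqVlt; apply/orP; left; apply/eqP; field.
by rewrite !gt_eqF.
Qed.

(* Entropy is bounded by the chi-square divergence: for g with values a and b,
   Ent(g^2) <= Var(g^2) / E g^2 <= 2 (a - b)^2, uniformly in the bias t. *)
Lemma two_point_log_sobolev (t a b u v ub : R) : 0 <= t <= 1 ->
  0 < u -> 0 < v -> ub = t * u + (1 - t) * v ->
  t * (a ^+ 2 * (ln u - ln ub)) + (1 - t) * (b ^+ 2 * (ln v - ln ub))
    <= 2 * (a - b) ^+ 2.
Proof.
move=> /andP[t0 t1] u0 v0 ubE.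
have q0 : 0 <= 1 - t by lra.
have ub0 : 0 < ub.
  rewrite ubE; have [->|t'] := eqVneq t 0; first by rewrite mul0r subr0 mul1r
    add0r.
  by rewrite ltr_wpDr ?mulr_ge0 ?(ltW v0) // mulr_gt0 // lt_neqAle eq_sym t'.
set M := t * a ^+ 2 + (1 - t) * b ^+ 2.
have ta0 : 0 <= t * a ^+ 2 by rewrite mulr_ge0 ?sqr_ge0.
have qb0 : 0 <= (1 - t) * b ^+ 2 by rewrite mulr_ge0 ?sqr_ge0.
have M0 : 0 <= M by rewrite addr_ge0.
have [M0'|M1] := eqVneq M 0.
  have -> : t * (a ^+ 2 * (ln u - ln ub)) = 0.
    by rewrite mulrA (_ : t * _ = 0) ?mul0r //; rewrite /M in M0'; lra.
  have -> : (1 - t) * (b ^+ 2 * (ln v - ln ub)) = 0.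
    by rewrite mulrA (_ : (1 - t) * _ = 0) ?mul0r //; rewrite /M in M0'; lra.
  by rewrite addr0 mulr_ge0 ?sqr_ge0.
have {M0 M1} M0 : 0 < M by rewrite lt_neqAle eq_sym M1.
have h1 := gibbs_term t0 (sqr_ge0 a) u0 ub0 M0.
have h2 := gibbs_term q0 (sqr_ge0 b) v0 ub0 M0.
rewrite 2!(mulrA _ _ (_ - ln ub)); apply: (le_trans (lerD h1 h2)).
have -> : t * (u * M / ub) + t * ((a ^+ 2) ^+ 2 / M) - 2 * (t * a ^+ 2) +
   ((1 - t) * (v * M / ub) + (1 - t) * ((b ^+ 2) ^+ 2 / M) -
    2 * ((1 - t) * b ^+ 2)) =
   t * (1 - t) * (a + b) ^+ 2 * (a - b) ^+ 2 / M.
  have -> : t * (u * M / ub) + t * ((a ^+ 2) ^+ 2 / M) - 2 * (t * a ^+ 2) +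
   ((1 - t) * (v * M / ub) + (1 - t) * ((b ^+ 2) ^+ 2 / M) -
    2 * ((1 - t) * b ^+ 2)) = ub / ub * M +
    (t * (a ^+ 2) ^+ 2 + (1 - t) * (b ^+ 2) ^+ 2) / M - 2 * M.
    rewrite /M; ring: ubE.
  rewrite divff ?gt_eqF // mul1r.
  apply: (mulIf (lt0r_neq0 M0)).
  rewrite mulrBl mulrDl !divfK ?gt_eqF // /M; ring.
rewrite ler_pdivrMr //.
have : t * (1 - t) * (a + b) ^+ 2 <= 2 * M.
  have h : (a + b) ^+ 2 <= 2 * (a ^+ 2 + b ^+ 2).
    rewrite -subr_ge0 (_ : _ - _ = (a - b) ^+ 2) ?sqr_ge0 //; ring.
  apply: (le_trans (ler_wpM2l (mulr_ge0 t0 q0) h)).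
  have h3 : t * (t * a ^+ 2) >= 0 by rewrite mulr_ge0.
  have h4 : (1 - t) * ((1 - t) * b ^+ 2) >= 0 by rewrite mulr_ge0.
  rewrite -subr_ge0 (_ : _ - _ = 2 * (t * (t * a ^+ 2) + (1 - t) * ((1 - t) * b
    ^+ 2))).
    by rewrite mulr_ge0 // addr_ge0.
  rewrite /M; ring.
move=> /(ler_wpM2r (sqr_ge0 (a - b))) /le_trans; apply.
by rewrite le_eqVlt; apply/orP; left; apply/eqP; ring.
Qed.

Variables (n : nat) (p : 'I_n -> bool -> R).
Hypothesis pP : coord_dist p.
Implicit Types (f g T : cube 'I_n -> R) (s : seq 'I_n).

Lemma av_gt0 i T : (forall x, 0 < T x) -> forall x, 0 < av p i T x.
Proof.
move=> T0 x; have e := coord_dist1 pP i.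
have [t0 f0] := (coord_dist_ge0 pP i true, coord_dist_ge0 pP i false).
rewrite /av; have [z|nz] := eqVneq (p i true) 0.
  by rewrite z mul0r add0r mulr_gt0 //; lra.
by rewrite ltr_wpDr ?mulr_ge0 ?(ltW (T0 _)) // mulr_gt0 // lt_neqAle eq_sym nz.
Qed.

(* Averaging T over one coordinate at a time makes ln T telescope. *)
Lemma log_sobolev_seq s g T : (forall x, 0 < T x) ->
  ex p (fun x => g x ^+ 2 * ln (T x)) <=
  ex p (fun x => g x ^+ 2 * ln (avs p s T x)) +
  2 * \sum_(i <- s) ex p (fun x => dd i g x ^+ 2).
Proof.
elim: s T => [|i s IH] T T0 /=; first by rewrite big_nil mulr0 addr0.
have := IH _ (av_gt0 i T0).
rewrite big_cons mulrDr.
have : ex p (fun x => g x ^+ 2 * ln (T x)) -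
    ex p (fun x => g x ^+ 2 * ln (av p i T x)) <=
    2 * ex p (fun x => dd i g x ^+ 2).
  rewrite -exB -exZ -(ex_av pP i); apply: ex_le => // x.
  have e := coord_dist1 pP i.
  have := @two_point_log_sobolev (p i true) (g (upd x i true))
    (g (upd x i false)) (T (upd x i true)) (T (upd x i false)) (av p i T x).
  rewrite coord_dist_ge0 // coord_dist_le1 // => /(_ isT (T0 _) (T0 _)).
  have <- : p i false = 1 - p i true by rewrite -e; ring.
  move=> /(_ erefl); rewrite /av !upd_same /dd.
  by move=> h; apply: le_trans h; rewrite le_eqVlt; apply/orP; left; apply/eqP;
    ring.
by lra.
Qed.

Lemma log_sobolev g T : (forall x, 0 < T x) ->
  ex p (fun x => g x ^+ 2 * ln (T x)) <=
  ex p (fun x => g x ^+ 2) * ln (ex p T) +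
  2 * \sum_i ex p (fun x => dd i g x ^+ 2).
Proof.
move=> /(log_sobolev_seq (enum 'I_n) g); rewrite big_enum /=.
move=> /le_trans; apply; rewrite lerD2r mulrC -exZ.
apply: ex_le => // x; rewrite mulrC (ex_free_avs pP (s := enum 'I_n) x) //.
by move=> i; rewrite mem_enum.
Qed.

End LogSobolev.

(** * Events of small total influence are nearly juntas *)

Section Projection.
Variables (R : realType) (n : nat).
Implicit Types (B D H : {set 'I_n}) (x c : cube 'I_n) (A : pred (cube 'I_n)).

Definition mix B x c : cube 'I_n := [ffun i => if i \in B then c i else x i].

(* The strings that B can move into A. *)
Definition proj B A : pred (cube 'I_n) := fun x => [exists c, A (mix B x c)].

Definition ind A x : R := (A x)%:R.

Lemma mix_id B x : mix B x x = x.
Proof. by apply/ffunP=> i; rewrite ffunE if_same. Qed.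

Lemma mix_mixU B D x c c' : exists e, mix B (mix D x c) c' = mix (B :|: D) x e.
Proof.
exists (mix B c c'); apply/ffunP=> i; rewrite !ffunE inE.
by case: (i \in B); case: (i \in D).
Qed.

Lemma mixU_mix B D x e : mix (B :|: D) x e = mix B (mix D x e) e.
Proof.
by apply/ffunP=> i; rewrite !ffunE inE; case: (i \in B); case: (i \in D).
Qed.

Lemma projU B D A : proj D (proj B A) =1 proj (B :|: D) A.
Proof.
move=> x; apply/existsP/existsP => [[c /existsP[c' h]]|[e h]].
  by have [e eE] := mix_mixU B D x c c'; exists e; rewrite -eE.
by exists e; apply/existsP; exists e; rewrite -mixU_mix.
Qed.

Lemma sub_proj B A x : A x -> proj B A x.
Proof. by move=> Ax; apply/existsP; exists x; rewrite mix_id. Qed.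

Lemma projS B D A x : B \subset D -> proj B A x -> proj D A x.
Proof.
move=> BD /(sub_proj D); rewrite projU.
by rewrite (finset.setUidPr BD).
Qed.

Lemma proj_free B A i : i \in B -> free_of i (ind (proj B A)).
Proof.
move=> iB x c; rewrite /ind; congr (nat_of_bool _)%:R.
apply: eq_existsb => e; congr (A _); apply/ffunP=> j; rewrite !ffunE.
by case: eqP => // ->; rewrite iB.
Qed.

Lemma ind_le A A' x : (A x -> A' x) -> ind A x <= ind A' x.
Proof. by rewrite /ind; case: (A x) => [->|] //; rewrite ler0n. Qed.

Lemma ind_ge0 A x : 0 <= ind A x. Proof. exact: ler0n. Qed.

Lemma ind_le1 A x : ind A x <= 1.
Proof. by rewrite /ind; case: (A x); rewrite ?ler01. Qed.

Lemma ind_sqr A x : ind A x ^+ 2 = ind A x.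
Proof. by rewrite /ind; case: (A x); rewrite ?expr0n ?expr1n. Qed.

Lemma dd_ind_norm A i x : `|dd i (ind A) x| = dd i (ind A) x ^+ 2.
Proof.
rewrite /dd /ind; case: (A _); case: (A _); rewrite ?subrr ?normr0 ?expr0n //=.
  by rewrite subr0 normr1 expr1n.
by rewrite sub0r normrN1 sqrrN expr1n.
Qed.

End Projection.

Section Junta.
Variables (R : realType) (n : nat) (p : 'I_n -> bool -> R).
Hypothesis pP : coord_dist p.
Implicit Types (f g : cube 'I_n -> R) (s : seq 'I_n) (A : pred (cube 'I_n)).

Lemma threshold_bound (t u : R) : 0 < t < 1 -> 0 <= u ->
  u ^+ 2 * - ln t <= u ^+ 2 * ln (1 + u / t ^+ 2) + t * - ln t * u.
Proof.
move=> /andP[t0 t1] u0.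
have L0 : 0 <= - ln t by rewrite oppr_ge0 ln_le0 // ltW.
have ut0 : 0 <= u / t ^+ 2 by rewrite divr_ge0 // exprn_ge0 // ltW.
have [ut|ut] := leP t u.
  rewrite -[leLHS]addr0 lerD ?mulr_ge0 ?(ltW t0) // ler_wpM2l ?sqr_ge0 //.
  rewrite -lnV ?posrE // ler_ln ?posrE ?invr_gt0 //; last by rewrite ltr_pwDl.
  apply: (@le_trans _ _ (u / t ^+ 2)); last by rewrite lerDr.
  by rewrite ler_pdivlMr ?exprn_gt0 // expr2 mulrA mulVf ?gt_eqF // mul1r.
rewrite -[leLHS]add0r lerD //.
  by rewrite mulr_ge0 ?sqr_ge0 // ln_ge0 // lerDl.
rewrite expr2 -mulrA [leRHS](_ : _ = u * (t * - ln t)); last by ring.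
by rewrite ler_wpM2l // ler_wpM2r // ltW.
Qed.

(* The test function 1 + |f| / t^2 has mean at most 2, and its logarithm is at
   least - ln t wherever |f| >= t. *)
Lemma ex_sqr_threshold (t : R) f : 0 < t < 1 ->
  ex p (fun x => `|f x|) <= t ^+ 2 ->
  (- ln t - ln 2) * ex p (fun x => f x ^+ 2) <=
  2 * \sum_i ex p (fun x => dd i f x ^+ 2) + t * - ln t * ex p (fun x => `|f
    x|).
Proof.
move=> t01 ft; have t0 : 0 < t by case/andP: t01.
have tt0 : 0 < t ^+ 2 by rewrite exprn_gt0.
pose T x := 1 + `|f x| / t ^+ 2.
have T0 x : 0 < T x by rewrite /T ltr_pwDl // divr_ge0 // ltW.
have exT : ex p T <= 2.
  rewrite /T exD (ex_cst pP); under eq_ex => x do rewrite mulrC.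
  by rewrite exZ mulrC -[2]/(1 + 1) lerD2l ler_pdivrMr // mul1r.
have exT0 : 0 < ex p T.
  apply: (lt_le_trans ltr01); rewrite -(ex_cst pP 1); apply: ex_le => // x.
  by rewrite /T lerDl divr_ge0 // ltW.
have f20 : 0 <= ex p (fun x => f x ^+ 2) by apply: ex_ge0 => // x; exact:
  sqr_ge0.
have h1 := log_sobolev pP f T0.
have h2 : ex p (fun x => f x ^+ 2) * ln (ex p T) <= ex p (fun x => f x ^+ 2) *
  ln 2.
  by rewrite ler_wpM2l // ler_ln ?posrE.
have h3 : ex p (fun x => - ln t * f x ^+ 2) <=
    ex p (fun x => f x ^+ 2 * ln (T x) + t * - ln t * `|f x|).
  apply: ex_le => // x; rewrite mulrC.
  by have := threshold_bound t01 (normr_ge0 (f x)); rewrite real_normK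
    ?num_real.
rewrite exZ exD exZ in h3; lra.
Qed.

(* Applies the previous bound to the martingale differences f - av i f, whose
   Dirichlet forms telescope. *)
Lemma junta_seq (t : R) s f : 0 < t < 1 ->
  (forall i, i \in s -> ex p (fun x => `|dd i f x|) <= t ^+ 2) ->
  (- ln t - ln 2) *
    (ex p (fun x => f x ^+ 2) - ex p (fun x => avs p s f x ^+ 2)) <=
  2 * (\sum_i ex p (fun x => dd i f x ^+ 2) -
       \sum_i ex p (fun x => dd i (avs p s f) x ^+ 2)) +
  t * - ln t * \sum_(i <- s) ex p (fun x => `|dd i f x|).
Proof.
move=> t01; have /andP[t0 t1] := t01.
have tL : 0 <= t * - ln t by rewrite mulr_ge0 ?(ltW t0) // oppr_ge0 ln_le0 //
  ltW.
elim: s f => [|i s IH] f fs.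
  by rewrite big_nil /= !subrr !mulr0 addr0.
have h1 := @ex_sqr_threshold t (fun x => f x - av p i f x) t01
  (le_trans (ex_norm_sub_av pP i f) (fs i (mem_head _ _))).
have /IH h2 : forall j, j \in s -> ex p (fun x => `|dd j (av p i f) x|) <= t ^+
  2.
  move=> j js; apply: le_trans (ex_norm_dd_av pP j i f) (fs j _).
  by rewrite in_cons js orbT.
rewrite big_cons /=; rewrite (ex_sqr_sub_av pP) in h1.
have h3 : \sum_j ex p (fun x => dd j (fun y => f y - av p i f y) x ^+ 2) =
  \sum_j ex p (fun x => dd j f x ^+ 2) -
  \sum_j ex p (fun x => dd j (av p i f) x ^+ 2).
  by rewrite -sumrB; apply: eq_bigr => j _; rewrite (ex_dd_sub_av pP).
rewrite h3 in h1.
have h4 : t * - ln t * ex p (fun x => `|f x - av p i f x|) <=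
  t * - ln t * ex p (fun x => `|dd i f x|).
  by rewrite ler_wpM2l // ex_norm_sub_av.
have h5 : t * - ln t * \sum_(j <- s) ex p (fun x => `|dd j (av p i f) x|) <=
  t * - ln t * \sum_(j <- s) ex p (fun x => `|dd j f x|).
  by rewrite ler_wpM2l // ler_sum // => j _; rewrite ex_norm_dd_av.
lra.
Qed.

Definition infl A i : R := ex p (fun x => dd i (ind R A) x ^+ 2).

Lemma infl_ge0 A i : 0 <= infl A i.
Proof. by apply: ex_ge0 => // x; exact: sqr_ge0. Qed.

Lemma card_influential (t I : R) A : 0 < t -> \sum_i infl A i <= I ->
  #|[set i | t ^+ 2 < infl A i]|%:R * t ^+ 2 <= I.
Proof.
move=> t0; apply: le_trans; rewrite (bigID [pred i | t ^+ 2 < infl A i]) /=.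
rewrite -[leLHS]addr0 lerD ?sumr_ge0 // => [|i _]; last exact: infl_ge0.
rewrite mulr_natl -sumr_const big_mkcond [leRHS]big_mkcond ler_sum // => i _.
by rewrite inE; case: ltP => // /ltW.
Qed.

Lemma junta_control (t I e d : R) A : 0 < t < 1 -> 0 < - ln t - ln 2 ->
  0 <= e -> d <= ex p (ind R A) -> \sum_i infl A i <= I ->
  3 * I < (- ln t - ln 2) * (e * d) ->
  1 - e <= ex p (ind R (proj [set i | t ^+ 2 < infl A i] A)).
Proof.
move=> t01 L0 e0 dA sI Ibound; have /andP[t0 t1] := t01.
set H := [set i | _].
pose s := [seq i <- enum 'I_n | i \notin H].
have sE i : (i \in s) = (i \notin H) by rewrite mem_filter mem_enum andbT.
have I0 : 0 <= I by apply: le_trans sI; apply: sumr_ge0 => i _; exact: infl_ge0.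
have nE i : ex p (fun x => `|dd i (ind R A) x|) = infl A i.
  by apply: eq_ex => x; rewrite dd_ind_norm.
set a := avs p s (ind R A).
have a0 x : 0 <= a x.
  have -> : 0 = avs p s (fun=> 0) x.
    by rewrite -(ex_free_avs pP) ?(ex_cst pP).
  by apply: avs_le => // y; exact: ind_ge0.
have tL : t * - ln t <= 1.
  rewrite -lnV ?posrE // mulrC -ler_pdivlMr // mul1r.
  by apply: (le_trans (ln_le_sub1 _)); rewrite ?invr_gt0 // gerBl.
have V : ex p (ind R A) - ex p (fun x => a x ^+ 2) < e * d.
  rewrite -(ltr_pM2l L0); apply: le_lt_trans Ibound.
  have := @junta_seq t s (ind R A) t01.
  have -> : ex p (fun x => ind R A x ^+ 2) = ex p (ind R A).
    by apply: eq_ex => x; rewrite ind_sqr.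
  move=> /(_ _)/le_trans; apply.
    by move=> i; rewrite sE inE -leNgt nE.
  have h1 : 0 <= \sum_i ex p (fun x => dd i a x ^+ 2).
    by apply: sumr_ge0 => i _; apply: ex_ge0 => // x; exact: sqr_ge0.
  have h2 : \sum_i ex p (fun x => dd i (ind R A) x ^+ 2) <= I by [].
  have h3 : t * - ln t * \sum_(i <- s) ex p (fun x => `|dd i (ind R A) x|) <= 1
    * I.
    apply: ler_pM => //.
    - by rewrite mulr_ge0 ?(ltW t0) // oppr_ge0 ln_le0 // ltW.
    - by apply: sumr_ge0 => i _; apply: ex_ge0 => // x; exact: normr_ge0.
    - apply: le_trans sI; under eq_bigr => i _ do rewrite nE.
      rewrite big_filter big_mkcond big_enum /= ler_sum // => i _.
      by case: ifP => // _; exact: infl_ge0.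
  rewrite -/a; lra.
have aA : ex p a = ex p (ind R A) by rewrite /a (ex_avs pP).
have [x ax] : exists x, 1 - e <= a x.
  apply: contrapT => /forallNP na.
  have : ex p (fun x => e * a x) <= ex p (fun x => a x - a x ^+ 2).
    apply: ex_le => // x; have /negP := na x; rewrite -ltNge => /ltW ax.
    rewrite expr2 -[X in _ <= X - _]mul1r -mulrBl ler_wpM2r //; lra.
  rewrite exZ exB aA => h; have := ler_wpM2l e0 dA; lra.
rewrite (ex_free_avs pP (s := s) x).
  by apply: (le_trans ax); apply: avs_le => // y; apply: ind_le; exact:
    sub_proj.
by move=> i; rewrite sE negbK; exact: proj_free.
Qed.

End Junta.

(** * Random coalitions *)

Section RandomUnion.
Variables (R : realType) (n : nat) (J : finType) (w : J -> R).
Variable S : J -> {set 'I_n}.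
Implicit Types (phi psi : {set 'I_n} -> R) (D : {set 'I_n}).

(* The expectation of phi at the union of k independent random sets, each being
   S j with probability w j. *)
Fixpoint iterE (k : nat) phi : R :=
  if k is k'.+1 then \sum_j w j * iterE k' (fun D => phi (S j :|: D)%SET)
  else phi finset.set0.

Lemma eq_iterE k phi psi : phi =1 psi -> iterE k phi = iterE k psi.
Proof.
elim: k phi psi => [|k IH] phi psi e /=; first exact: e.
by apply: eq_bigr => j _; congr (_ * _); apply: IH => D.
Qed.

Lemma iterE_sum (T : finType) k (a : T -> R) (F : T -> {set 'I_n} -> R) :
  iterE k (fun D => \sum_t a t * F t D) = \sum_t a t * iterE k (F t).
Proof.
elim: k F => [//|k IH] F /=.
under eq_bigr => j _ do rewrite IH mulr_sumr.
rewrite exchange_big /=; apply: eq_bigr => t _.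
by rewrite mulr_sumr; apply: eq_bigr => j _; rewrite mulrCA.
Qed.

Lemma iterED k phi psi :
  iterE k (fun D => phi D + psi D) = iterE k phi + iterE k psi.
Proof.
elim: k phi psi => [//|k IH] phi psi /=.
by rewrite -big_split; apply: eq_bigr => j _; rewrite IH mulrDr.
Qed.

Lemma iterEZ k a phi : iterE k (fun D => a * phi D) = a * iterE k phi.
Proof.
elim: k phi => [//|k IH] phi /=.
by rewrite mulr_sumr; apply: eq_bigr => j _; rewrite IH mulrCA.
Qed.

Lemma iterEB k phi psi :
  iterE k (fun D => phi D - psi D) = iterE k phi - iterE k psi.
Proof.
rewrite iterED; congr (_ + _); rewrite -mulN1r -iterEZ.
by apply: eq_iterE => D; rewrite mulN1r.
Qed.

Lemma iterES k phi :
  iterE k.+1 phi = iterE k (fun D => \sum_j w j * phi (S j :|: D)%SET).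
Proof. by rewrite iterE_sum. Qed.

Lemma iterE_add k l phi :
  iterE (k + l) phi = iterE k (fun D => iterE l (fun D' => phi (D :|: D')%SET)).
Proof.
elim: k phi => [|k IH] phi /=; first by apply: eq_iterE => D; rewrite
  finset.set0U.
apply: eq_bigr => j _; congr (_ * _); rewrite IH.
by apply: eq_iterE => D; apply: eq_iterE => D'; rewrite finset.setUA.
Qed.

Hypotheses (w0 : forall j, 0 <= w j) (w1 : \sum_j w j = 1).

Lemma iterE_cst k a : iterE k (fun=> a) = a.
Proof.
elim: k => //= k IH; rewrite IH -mulr_suml.
by rewrite (_ : \sum_j w j = 1) // mul1r.
Qed.

Lemma iterE_le k phi psi : (forall D, phi D <= psi D) ->
  iterE k phi <= iterE k psi.
Proof.
elim: k phi psi => [|k IH] phi psi e /=; first exact: e.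
by apply: ler_sum => j _; rewrite ler_wpM2l //; apply: IH => D.
Qed.

Lemma iterE_ge0 k phi : (forall D, 0 <= phi D) -> 0 <= iterE k phi.
Proof. by move=> h; rewrite -(iterE_cst k 0); apply: iterE_le. Qed.

Lemma iterE_le_card k phi psi : (forall j, (#|S j| <= 1)%N) ->
  (forall D, (#|D| <= k)%N -> phi D <= psi D) ->
  iterE k phi <= iterE k psi.
Proof.
move=> S1; elim: k phi psi => [|k IH] phi psi e /=.
  by apply: e; rewrite cards0.
apply: ler_sum => j _; rewrite ler_wpM2l //; apply: IH => D Dk.
apply: e; apply: leq_trans (leq_card_setU _ _) _.
by rewrite -(add1n k) leq_add.
Qed.

Lemma iterE_addr_ge k l phi :
  (forall D D', D \subset D' -> phi D <= phi D') ->
  iterE k phi <= iterE (k + l) phi.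
Proof.
move=> mon; rewrite iterE_add; apply: iterE_le => D.
rewrite -{1}(iterE_cst l (phi D)); apply: iterE_le => D'.
by apply: mon; apply: finset.subsetUl.
Qed.

Lemma markov k phi (a : R) : (forall D, 0 <= phi D) -> 0 < a ->
  iterE k phi <= a / 2 -> 1 / 2 <= iterE k (fun D => (phi D <= a)%R%:R).
Proof.
move=> phi0 a0 h; apply: (@le_trans _ _ (iterE k (fun D => 1 - a^-1 * phi D))).
  rewrite iterEB iterE_cst iterEZ.
  have : a^-1 * iterE k phi <= a^-1 * (a / 2) by rewrite ler_wpM2l // invr_ge0
    ltW.
  by rewrite mulrA mulVf ?gt_eqF //; lra.
apply: iterE_le => D; have h0 : 0 <= a^-1 * phi D by rewrite mulr_ge0 //
  invr_ge0 ltW.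
case: (leP (phi D) a) => [_|aD] /=; first by lra.
suff : 1 <= a^-1 * phi D by lra.
rewrite mulrC ler_pdivlMr // mul1r; exact: ltW.
Qed.

End RandomUnion.

Section Sampling.
Variables (R : realType) (n : nat).
Hypothesis n0 : (0 < n)%N.
Implicit Types (D H : {set 'I_n}).

Definition sampleE := iterE (fun _ : 'I_n => n%:R^-1 : R) (fun i => [set
  i]%SET).

Lemma sample_weight_ge0 (i : 'I_n) : 0 <= n%:R^-1 :> R. Proof. by rewrite
  invr_ge0. Qed.

Lemma sample_weight1 : \sum_(i < n) n%:R^-1 = 1 :> R.
Proof. by rewrite sumr_const card_ord -[LHS]mulr_natr mulVf // pnatr_eq0 -lt0n.
  Qed.

Let w0 := sample_weight_ge0.
Let w1 := sample_weight1.

Lemma sampleE_mem i l : (l <= n)%N ->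
  l%:R / (2 * n)%:R <= sampleE l (fun D => (i \in D)%:R).
Proof.
move=> ln; apply: (@le_trans _ _ (l%:R / (n + l)%:R)).
  have nR : 0 < n%:R :> R by rewrite ltr0n.
  rewrite ler_wpM2l // lef_pV2 ?posrE ?ltr0n ?addn_gt0 ?muln_gt0 ?n0 //.
  by rewrite ler_nat mul2n -addnn leq_add2l.
elim: l {ln} => [|l IH]; first by rewrite mul0r /= inE.
rewrite /sampleE /= (bigD1 i) //=.
have -> : iterE (fun=> n%:R^-1 : R) (fun i => [set i]%SET) l
    (fun D => (i \in ([set i] :|: D)%SET)%:R) = 1.
  rewrite -[RHS](iterE_cst (fun i => [set i]%SET) w1 l 1).
  by apply: eq_iterE => D; rewrite !inE eqxx.
have h : \sum_(j < n | j != i) n%:R^-1 * (l%:R / (n + l)%:R) <=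
   \sum_(j < n | j != i) n%:R^-1 * iterE (fun=> n%:R^-1 : R) (fun i => [set
     i]%SET) l
    (fun D => (i \in ([set j] :|: D)%SET)%:R).
  apply: ler_sum => j ji; rewrite ler_wpM2l ?invr_ge0 //; apply: (le_trans IH).
  apply: iterE_le => // D; rewrite !inE.
  by rewrite eq_sym (negPf ji).
apply: le_trans _ (lerD (lexx _) h).
have -> : \sum_(j < n | j != i) n%:R^-1 * (l%:R / (n + l)%:R) =
   (1 - n%:R^-1) * (l%:R / (n + l)%:R) :> R.
  rewrite -mulr_suml; congr (_ * _).
  have e : \sum_(j < n) n%:R^-1 = n%:R^-1 + \sum_(j < n | j != i) n%:R^-1 :> R.
    by rewrite (bigD1 i).
  by apply: (addrI n%:R^-1); rewrite -e w1 addrC subrK.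
have nR : 0 < n%:R :> R by rewrite ltr0n.
have lR : 0 <= l%:R :> R by [].
rewrite !natrD -[l.+1]addn1 !natrD.
rewrite ler_pdivrMr; last by lra.
have nl0 : 0 < n%:R + l%:R :> R by lra.
rewrite (_ : n%:R^-1 * 1 + _ = (l%:R + 1) / (n%:R + l%:R)).
  rewrite mulrAC ler_pdivlMr // ler_wpM2l ?addr_ge0 //; lra.
field; rewrite !gt_eqF //.
Qed.

Lemma sampleE_subset H l k : (l <= n)%N -> (#|H| * l <= k)%N ->
  (l%:R / (2 * n)%:R) ^+ #|H| <= sampleE k (fun D => (H \subset D)%:R).
Proof.
move=> ln Hk; rewrite -(subnKC Hk).
apply: le_trans; last first.
  apply: iterE_addr_ge => //.
  move=> D D' DD'; rewrite ler_nat; case: (boolP (H \subset D)) => //= HD.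
  by rewrite (fintype.subset_trans HD DD').
have : [set:: enum H]%SET = H by apply/finset.setP => i; rewrite inE mem_enum.
rewrite cardE; move: (enum H) => s {Hk}; elim: s H => [|i s IH] H sH.
  rewrite /= expr0 -sH (_ : [set:: [::]]%SET = finset.set0) ?finset.sub0set //.
rewrite mulSn exprS /sampleE iterE_add.
have l0 : 0 <= l%:R / (2 * n)%:R :> R by rewrite divr_ge0.
have := ler_pM l0 (exprn_ge0 (size s) l0) (sampleE_mem i ln) (IH _ erefl).
move=> /le_trans; apply; rewrite mulrC /sampleE -iterEZ.
apply: iterE_le => // D; rewrite mulrC -iterEZ; apply: iterE_le => // D'.
rewrite -sH -natrM ler_nat mulnb.
case: (boolP (i \in D)) => //= iD; case: (boolP ([set:: s]%SET \subset D')) =>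
  //= sD'.
suff -> : ([set:: i :: s] \subset D :|: D')%SET by [].
apply/fintype.subsetP => j; rewrite !inE => /orP[/eqP ->|js]; first by rewrite
  iD.
by rewrite (fintype.subsetP sD') ?orbT // inE.
Qed.

End Sampling.

Section Boost.
Variables (R : realType) (n : nat) (p : 'I_n -> bool -> R).
Hypotheses (n0 : (0 < n)%N) (pP : coord_dist p).
Implicit Types (A : pred (cube 'I_n)) (D B H : {set 'I_n}).

Definition measure A : R := ex p (ind R A).

Lemma measure_ge0 A : 0 <= measure A.
Proof. by apply: ex_ge0 => // x; exact: ind_ge0. Qed.

Lemma measure_le1 A : measure A <= 1.
Proof. by rewrite -(ex_cst pP 1); apply: ex_le => // x; exact: ind_le1. Qed.

Lemma measureS A A' : (forall x, A x -> A' x) -> measure A <= measure A'.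
Proof. by move=> s; apply: ex_le => // x; apply: ind_le; exact: s. Qed.

Lemma eq_measure A A' : A =1 A' -> measure A = measure A'.
Proof. by move=> e; apply: eq_ex => x; rewrite /ind e. Qed.

Lemma measure_projS A B D : B \subset D ->
  measure (proj B A) <= measure (proj D A).
Proof. by move=> BD; apply: measureS => x; exact: projS. Qed.

Definition gain A i : R := measure (proj [set i]%SET A) - measure A.

Lemma gain_ge0 A i : 0 <= gain A i.
Proof. by rewrite subr_ge0; apply: measureS => x; exact: sub_proj. Qed.

Lemma infl_le_gain (tau : R) A i : (forall j c, tau <= p j c) ->
  tau * infl p A i <= gain A i.
Proof.
move=> pt; rewrite /gain /measure /infl -exZ -exB -[leRHS](ex_av pP i).
apply: ex_le => // x.
have h c c' : A (upd x i c) -> proj [set i]%SET A (upd x i c').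
  move=> Ax; apply/existsP; exists (upd x i c).
  suff -> : mix [set i]%SET (upd x i c') (upd x i c) = upd x i c by [].
  by apply/ffunP=> j; rewrite !ffunE inE; case: eqP.
have [p1 p2] := (pt i true, pt i false).
have [q1 q2] := (coord_dist_ge0 pP i true, coord_dist_ge0 pP i false).
have := coord_dist1 pP i; rewrite /av /dd /ind.
move: (h true true) (h true false) (h false true) (h false false).
case: (A (upd x i true)) => [/(_ isT)->/(_ isT)-> _ _|_ _].
  by case: (A (upd x i false)) => /=; lra.
case: (A (upd x i false)) => [/(_ isT)->/(_ isT)->|_ _] /=; first by lra.
by move=> _; rewrite !(subrr, expr0n, mulr0, addr0, subr0) /= addr_ge0 //
  mulr_ge0.
Qed.

(* The gain of a random player is the increment of the expected measure of
   proj B A, which grows by at most 1 altogether. *)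
Lemma exists_low_gain A k : (0 < k)%N -> exists2 m, (m < k)%N &
  sampleE m (fun B => \sum_i gain (proj B A) i) <= n%:R / k%:R :> R.
Proof.
move=> k0; apply: contrapT => /forall2NP na.
pose h m : R := sampleE m (fun B => measure (proj B A)).
have step m : h m.+1 - h m =
    n%:R^-1 * sampleE m (fun B => \sum_i gain (proj B A) i).
  rewrite /h /sampleE iterES -iterEB -iterEZ; apply: eq_iterE => B.
  rewrite /gain sumrB sumr_const card_ord mulrBr -mulr_sumr.
  rewrite -[measure (proj B A) *+ n]mulr_natl mulrA mulVf ?mul1r ?pnatr_eq0
    -?lt0n //.
  congr (_ * _ - _); apply: eq_bigr => i _; apply: eq_measure => x.
  by rewrite projU finset.setUC.
have nR : 0 < n%:R :> R by rewrite ltr0n.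
have kR : 0 < k%:R :> R by rewrite ltr0n.
have step_gt m : (m < k)%N -> k%:R^-1 < h m.+1 - h m.
  move=> mk; rewrite step mulrC ltr_pdivlMr // mulrC.
  by case: (na m) => // /negP; rewrite -ltNge.
have hk m : (m <= k)%N -> m%:R / k%:R <= h m - h 0%N.
  elim: m => [|m IH] mk; first by rewrite mul0r subrr.
  have := IH (ltnW mk); have := step_gt m mk.
  rewrite -[m.+1]addn1 natrD mulrDl mul1r; lra.
have h1 : h k <= 1.
  rewrite /h -[leRHS](iterE_cst (fun i => [set i]%SET) (sample_weight1 R n0) k).
  by apply: (iterE_le _ (@sample_weight_ge0 R n)) => B; rewrite measure_le1.
have h0 : 0 <= h 0%N by exact: measure_ge0.
case: k k0 {na} kR step_gt hk h1 => // k _ kR step_gt hk h1.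
have := hk k (leqnSn k); have := step_gt k (ltnSn k).
have : k%:R / k.+1%:R + k.+1%:R^-1 = 1 :> R.
  by rewrite -[X in _ + X]mul1r -mulrDl -natr1 divff // natr1 gt_eqF.
move: (k.+1%:R^-1) (k%:R / k.+1%:R) (h k.+1) (h k) (h 0%N) h0 h1 => v u a b c;
  lra.
Qed.

Lemma boost (e d t tau : R) (k l m : nat) A :
  0 <= e -> 0 < tau -> (forall i c, tau <= p i c) -> (0 < k)%N ->
  0 < t < 1 -> 0 < - ln t - ln 2 ->
  3 * (2 * (n%:R / k%:R) / tau) < (- ln t - ln 2) * (e * d) ->
  2 * (n%:R / k%:R) / tau <= m%:R * t ^+ 2 ->
  (m * l <= k)%N -> (l <= n)%N -> d <= measure A ->
  1 / 2 * (l%:R / (2 * n)%:R) ^+ m <=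
    sampleE (k + k) (fun B => (1 - e <= measure (proj B A))%R%:R) :> R.
Proof.
move=> e0 tau0 pt k0 t01 L0 bI bm mlk l_n dA.
have /andP[t0 t1] := t01.
have nR : 0 < n%:R :> R by rewrite ltr0n.
have kR : 0 < k%:R :> R by rewrite ltr0n.
have [j jk hj] := exists_low_gain A k0.
set ph := fun B => (1 - e <= measure (proj B A))%R%:R : R.
have jkk : (j + (k + k - j) = k + k)%N by rewrite subnKC // (leq_trans (ltnW
  jk)) ?leq_addr.
have l0 : 0 <= l%:R / (2 * n)%:R :> R by rewrite divr_ge0.
have l1 : l%:R / (2 * n)%:R <= 1 :> R.
  rewrite ler_pdivrMr ?mul1r ?ler_nat ?ltr0n ?muln_gt0 ?n0 //.
  by rewrite (leq_trans l_n) // mul2n -addnn leq_addr.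
pose a : R := 2 * (n%:R / k%:R).
have a0 : 0 < a by rewrite mulr_gt0 // divr_gt0.
have := @markov R n _ _ (fun i => [set i]%SET) (@sample_weight_ge0 R n)
  (sample_weight1 R n0) j (fun B => \sum_i gain (proj B A) i) a.
move=> /(_ _ a0 _)/(ler_wpM2r (exprn_ge0 m l0))/le_trans; apply.
- by move=> B; apply: sumr_ge0 => i _; exact: gain_ge0.
- by apply: (le_trans hj); rewrite /a; lra.
rewrite -jkk /sampleE iterE_add mulrC -iterEZ.
apply: (iterE_le _ (@sample_weight_ge0 R n)) => B.
have [low|_] := leP _ a; last by rewrite mulr0; apply: (iterE_ge0 _
  (@sample_weight_ge0 R n) (sample_weight1 R n0)).
rewrite mulr1; pose A' := proj B A; pose H := [set i | t ^+ 2 < infl p A'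
  i]%SET.
have sI : \sum_i infl p A' i <= a / tau.
  rewrite ler_pdivlMr //; apply: le_trans low; rewrite mulr_suml.
  by apply: ler_sum => i _; rewrite mulrC infl_le_gain.
have ctl : 1 - e <= measure (proj H A').
  apply: (@junta_control _ _ p pP t (a / tau) e d) => //.
  by apply: (le_trans dA); apply: measureS => x; exact: sub_proj.
have cH : (#|H| <= m)%N.
  have := le_trans (card_influential pP t0 sI) bm.
  by rewrite ler_pM2r ?exprn_gt0 // ler_nat.
have Hk : (#|H| * l <= k + k - j)%N.
  apply: (@leq_trans (m * l)); first by rewrite leq_mul2r cH orbT.
  by apply: (leq_trans mlk); rewrite -addnBA ?leq_addr //; exact: ltnW jk.
apply: le_trans (le_trans _ (sampleE_subset R n0 l_n Hk)) _.
  by apply: ler_wiXn2l.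
apply: (iterE_le _ (@sample_weight_ge0 R n)) => D.
rewrite /ph; case: (boolP (H \subset D)) => //= HD; rewrite ler_nat.
suff -> : 1 - e <= measure (proj (B :|: D)%SET A) by [].
apply: (le_trans ctl); rewrite (eq_measure (projU B H A)).
by apply: measure_projS; apply: finset.setUS.
Qed.
End Boost.

(** * Multi-round games *)

Section GameValue.
Variables (R : realType) (n : nat).
Implicit Types (b : bool) (B D : {set 'I_n}) (p : nat -> 'I_n -> bool -> R).
Implicit Types (F : seq (cube 'I_n) -> bool) (x c : cube 'I_n).

(* The optimal probability with which B forces the outcome b, the bad bits of a
   round being chosen after the good ones. *)
Fixpoint value b r p B F : R :=
  if r is r'.+1 then
    ex (p 0%N) (fun x => \big[Num.max/0]_(c : cube 'I_n)
      value b r' (fun k => p k.+1) B (fun s => F (mix B x c :: s)))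
  else (F [::] == b)%:R.

Definition controls (e : R) r p F B :=
  (1 - e <= value true r p B F) || (1 - e <= value false r p B F).

Lemma value_ge0 b r p B F : (forall k, coord_dist (p k)) -> 0 <= value b r p B
  F.
Proof.
elim: r p F => [|r IH] p F pP /=; first exact: ler0n.
by apply: ex_ge0 => // x; apply: bigmax_ge_id.
Qed.

Lemma value_le1 b r p B F : (forall k, coord_dist (p k)) -> value b r p B F <=
  1.
Proof.
elim: r p F => [|r IH] p F pP /=; first by case: (_ == _); rewrite ?ler01.
rewrite -[leRHS](ex_cst (pP 0%N)); apply: ex_le => // x.
by apply: bigmax_le => // c _; apply: IH.
Qed.

Lemma valueS b r p B D F : (forall k, coord_dist (p k)) -> B \subset D ->
  value b r p B F <= value b r p D F.
Proof.
move=> pP BD; elim: r p F pP => [|r IH] p F pP //=.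
apply: ex_le => // x; apply: bigmax_le => [|c _]; first exact: bigmax_ge_id.
apply: (le_trans (IH _ _ _)) => //.
have -> : mix B x c = mix D x (mix B x c).
  apply/ffunP=> i; rewrite !ffunE; case: ifP => iB; last by rewrite if_same.
  by rewrite (fintype.subsetP BD).
exact: le_bigmax.
Qed.

Lemma value_step_ge b r p B D F (e e' : R) : (forall k, coord_dist (p k)) ->
  0 <= e -> 0 <= e' <= 1 ->
  1 - e <= measure (p 0%N) (proj D (fun x =>
    1 - e' <= value b r (fun k => p k.+1) B (fun s => F (x :: s)))) ->
  1 - (e + e') <= value b r.+1 p (B :|: D)%SET F.
Proof.
move=> pP e0 /andP[e'0 e'1] h.
have q : 1 - (e + e') <= (1 - e) * (1 - e').
  by have : 0 <= e * e' by [rewrite mulr_ge0]; lra.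
apply: (le_trans q).
have e1 : 0 <= 1 - e' by lra.
apply: (le_trans (ler_wpM2r e1 h)).
rewrite /= /measure mulrC -exZ; apply: ex_le => // x; rewrite /ind.
case: (boolP (proj D _ x)) => [/existsP[c hc]|_] /=; last by rewrite mulr0;
  apply: bigmax_ge_id.
rewrite mulr1; apply: (le_trans hc).
apply: (@le_trans _ _ (value b r (fun k => p k.+1) (B :|: D)%SET
   (fun s => F (mix D x c :: s)))).
  by apply: valueS => //; apply: finset.subsetUl.
have -> : mix D x c = mix (B :|: D)%SET x (mix D x c).
  apply/ffunP=> i; rewrite !ffunE inE; case: (i \in D); rewrite ?orbT //.
  by rewrite if_same.
exact: le_bigmax.
Qed.

Lemma controls_step (e e' sg rh : R) r p N k F : (0 < n)%N ->
  (forall j, coord_dist (p j)) -> 0 <= e -> 0 <= e' <= 1 -> 0 <= sg -> 0 <= rh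
    ->
  (forall F, sg <= sampleE N (fun B =>
     (controls e' r (fun j => p j.+1) F B)%:R) :> R) ->
  (forall A, sg / 4 <= measure (p 0%N) A ->
     rh <= sampleE k (fun B => (1 - e <= measure (p 0%N) (proj B A))%R%:R) :>
       R) ->
  sg / 4 * rh <= sampleE (N + k) (fun B => (controls (e + e') r.+1 p F B)%:R)
    :> R.
Proof.
move=> n0 pP e0 e'01 sg0 rh0 hN hk.
pose E b B : pred (cube 'I_n) :=
  fun x => 1 - e' <= value b r (fun k => p k.+1) B (fun s => F (x :: s)).
pose M B : R := measure (p 0%N) (E true B) + measure (p 0%N) (E false B).
have hM : sg <= sampleE N M.
  have -> : sampleE N M = ex (p 0%N) (fun x =>
      sampleE N (fun B => ind R (E true B) x + ind R (E false B) x)).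
    rewrite /sampleE /ex -iterE_sum; apply: eq_iterE => B.
    rewrite /M /measure -exD; apply: eq_bigr => x _; congr (_ * _).
  rewrite -(ex_cst (pP 0%N) sg); apply: ex_le => // x.
  apply: (le_trans (hN (fun s => F (x :: s)))).
  apply: (iterE_le _ (@sample_weight_ge0 R n)) => B; rewrite /ind /controls.
  rewrite -/(E true B x) -/(E false B x).
  by case: (E true B x); case: (E false B x); rewrite -natrD ler_nat.
have M2 B : M B <= 2 by rewrite -[2]/(1 + 1) lerD ?measure_le1.
rewrite mulrC /sampleE iterE_add.
have h2 : sg / 4 <= sampleE N (fun B => (sg / 2 <= M B)%R%:R).
  apply: (@le_trans _ _ (sampleE N (fun B => 2^-1 * (M B - sg / 2)))).
    rewrite /sampleE iterEZ iterEB.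
    rewrite (iterE_cst _ (sample_weight1 R n0)); rewrite /sampleE in hM; lra.
  apply: (iterE_le _ (@sample_weight_ge0 R n)) => B.
  by have := M2 B; case: (leP (sg / 2) (M B)) => h /=; lra.
apply: (le_trans (ler_wpM2l rh0 h2)); rewrite /sampleE -iterEZ.
apply: (iterE_le _ (@sample_weight_ge0 R n)) => B.
have [hB|_] := leP (sg / 2) (M B); last first.
  by rewrite mulr0; apply: (iterE_ge0 _ (@sample_weight_ge0 R n)
    (sample_weight1 R n0)).
have [b hb] : exists b, sg / 4 <= measure (p 0%N) (E b B).
  case: (leP (sg / 4) (measure (p 0%N) (E true B))) => h; first by exists true.
  by exists false; rewrite /M in hB; lra.
rewrite mulr1; apply: (le_trans (hk _ hb)).
apply: (iterE_le _ (@sample_weight_ge0 R n)) => D; rewrite ler_nat.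
case: leP => //= h; rewrite lt0b /controls.
by have := value_step_ge pP e0 e'01 h; case: b {hb h} => ->; rewrite ?orbT.
Qed.

End GameValue.

(** * Mixing with fair coins *)

Section Dilution.
Variables (R : realType) (n : nat) (beta : R).
Hypothesis beta01 : 0 <= beta <= 1.
Implicit Types (b : bool) (B D : {set 'I_n}) (f : cube 'I_n -> R).
Implicit Types (F : seq (cube 'I_n) -> bool) (x : cube 'I_n) (u : cube 'I_n).

Definition dilute (p : 'I_n -> bool -> R) i c : R :=
  (1 - beta) * p i c + beta / 2.

Definition bernoulli (i : 'I_n) (c : bool) : R := if c then beta else 1 - beta.

Definition bernoulli_weight (u : cube 'I_n) : R := \prod_i bernoulli i (u i).

Definition support (u : cube 'I_n) : {set 'I_n} := [set i | u i]%SET.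

Lemma bernoulli_dist : coord_dist bernoulli.
Proof.
move=> i; split=> [c|]; last by rewrite /bernoulli addrC subrK.
by rewrite /bernoulli; case: c; case/andP: beta01; lra.
Qed.

Lemma bernoulli_weight_ge0 u : 0 <= bernoulli_weight u.
Proof. by apply: prodr_ge0 => i _; exact: coord_dist_ge0 bernoulli_dist _ _.
  Qed.

Lemma bernoulli_weight1 : \sum_u bernoulli_weight u = 1.
Proof.
rewrite -[RHS](ex_cst bernoulli_dist 1).
by apply: eq_bigr => u _; rewrite mulr1.
Qed.

Lemma sum_bernoulli_support :
  \sum_u bernoulli_weight u * #|support u|%:R = n%:R * beta.
Proof.
have -> : \sum_u bernoulli_weight u * #|support u|%:R =
    ex bernoulli (fun u => \sum_i (u i)%:R).
  apply: eq_bigr => u _; congr (_ * _).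
  by rewrite -natr_sum -big_mkcond sum1_card; congr (_%:R); apply: eq_card =>
    i; rewrite inE.
rewrite ex_sum; under eq_bigr => i _.
  rewrite -(ex_av bernoulli_dist i).
  under eq_ex => u do rewrite /av !upd_at mulr1 mulr0 addr0.
  rewrite (ex_cst bernoulli_dist); over.
by rewrite sumr_const card_ord mulr_natl.
Qed.

Lemma dilute_dist p : coord_dist p -> coord_dist (dilute p).
Proof.
move=> pP i; have /andP[b0 b1] := beta01.
split=> [c|].
  by rewrite addr_ge0 ?mulr_ge0 ?(coord_dist_ge0 pP) ?invr_ge0 //; lra.
have := coord_dist1 pP i; rewrite /dilute.
have -> : (1 - beta) * p i true + beta / 2 + ((1 - beta) * p i false + beta / 2)
   = (1 - beta) * (p i true + p i false) + beta by field.
by move=> ->; ring.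
Qed.

Lemma dilute_ge p i c : coord_dist p -> beta / 2 <= dilute p i c.
Proof.
move=> pP; have /andP[b0 b1] := beta01.
by rewrite /dilute lerDr mulr_ge0 ?(coord_dist_ge0 pP) //; lra.
Qed.

Lemma avs_agree (p q : 'I_n -> bool -> R) s f :
  (forall i c, i \in s -> p i c = q i c) -> avs p s f = avs q s f.
Proof.
elim: s f => //= i s IH f pq.
rewrite IH; last by move=> j c js; apply: pq; rewrite in_cons js orbT.
congr (avs q s _); apply/funext => x; rewrite /av.
by rewrite !pq // mem_head.
Qed.

(* A diluted coordinate is, with probability beta, replaced by a fair coin;
   a coalition containing the replaced coordinates can do at least as well. *)
Lemma ex_dilute_le p f (g : cube 'I_n -> cube 'I_n -> R) : coord_dist p ->
  (forall x, 0 <= f x) ->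
  (forall u x c, f (mix (support u) x c) <= g u x) ->
  ex (dilute p) f <= \sum_u bernoulli_weight u * ex p (g u).
Proof.
move=> pP f0 fg.
pose q u i c : R := if u i then 2^-1 else p i c.
have -> : ex (dilute p) f = \sum_u bernoulli_weight u * ex (q u) f.
  have e x : \prod_i dilute p i (x i) =
      \sum_u bernoulli_weight u * \prod_i q u i (x i).
    transitivity (\prod_i \sum_(c : bool)
        bernoulli i c * (if c then 2^-1 else p i (x i))).
      by apply: eq_bigr => i _; rewrite big_bool /bernoulli /dilute addrC.
    rewrite (bigA_distr_bigA (fun i c => bernoulli i c * (if c then 2^-1 else p
      i (x i)))).
    by apply: eq_bigr => u _; rewrite -big_split.
  rewrite /ex; under eq_bigr => x _ do rewrite e mulr_suml.
  rewrite exchange_big; apply: eq_bigr => u _.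
  by rewrite mulr_sumr; apply: eq_bigr => x _; rewrite mulrA.
apply: ler_sum => u _; rewrite ler_wpM2l ?bernoulli_weight_ge0 //.
have qP : coord_dist (q u).
  move=> i; rewrite /q; case: (u i); last exact: pP.
  by split=> [_|]; [rewrite invr_ge0|field].
pose h x : R := \big[Num.max/0]_(c : cube 'I_n) f (mix (support u) x c).
have fh x : f x <= h x.
  by rewrite -{1}(mix_id (support u) x); apply: le_bigmax.
have hfree i : i \in support u -> free_of i h.
  move=> iu x c; apply: eq_bigr => d _; congr (f _).
  by apply/ffunP=> j; rewrite !ffunE; case: (eqVneq j i) => // ->; rewrite iu.
pose s := [seq i <- enum 'I_n | i \notin support u].
have sE i : (i \in s) = (i \notin support u) by rewrite mem_filter mem_enum
  andbT.
apply: (le_trans (ex_le qP fh)).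
have sfree i : i \notin s -> free_of i h by rewrite sE negbK; exact: hfree.
have x0 : cube 'I_n by exact: [ffun=> false].
rewrite (ex_free_avs qP x0 sfree) (_ : avs (q u) s h = avs p s h); last first.
  by apply: avs_agree => i c; rewrite sE inE /q => /negPf ->.
rewrite -(ex_free_avs pP x0 sfree); apply: ex_le => // x.
apply: bigmax_le => [|c _]; last exact: fg.
by apply: le_trans (f0 _) (fg u x x).
Qed.

Lemma value_dilute_le b r (p : nat -> 'I_n -> bool -> R) B F :
  (forall k, coord_dist (p k)) ->
  value b r (fun k => dilute (p k)) B F <=
  iterE bernoulli_weight support r (fun D => value b r p (B :|: D)%SET F).
Proof.
elim: r p F => [|r IH] p F pP; first by [].
rewrite [value _ _ _ _ _]/=.
pose g u x : R := iterE bernoulli_weight support r (fun D =>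
  \big[Num.max/0]_(c : cube 'I_n) value b r (fun k => p k.+1)
    (B :|: (support u :|: D))%SET
    (fun s => F (mix (B :|: (support u :|: D))%SET x c :: s))).
have -> : iterE bernoulli_weight support r.+1
    (fun D => value b r.+1 p (B :|: D)%SET F) =
    \sum_u bernoulli_weight u * ex (p 0%N) (g u).
  by apply: eq_bigr => u _; congr (_ * _); rewrite /g /ex -iterE_sum.
apply: ex_dilute_le => // [x|u x y].
  exact: bigmax_ge_id.
have g0 : 0 <= g u x.
  apply: (iterE_ge0 _ bernoulli_weight_ge0 bernoulli_weight1) => D.
  exact: bigmax_ge_id.
apply: bigmax_le => // c _.
have [e ->] := mix_mixU B (support u) x y c.
apply: (le_trans (IH _ _ _)) => //.
apply: (iterE_le _ bernoulli_weight_ge0) => D.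
apply: (@le_trans _ _ (value b r (fun k => p k.+1) (B :|: (support u :|: D))%SET
    (fun s => F (mix (B :|: support u) x e :: s)))).
  by apply: valueS => //; apply: finset.setUS; apply: finset.subsetUr.
have -> : mix (B :|: support u) x e =
    mix (B :|: (support u :|: D))%SET x (mix (B :|: support u) x e).
  apply/ffunP=> i; rewrite !ffunE !inE.
  by case: (i \in B); case: (u i); case: (i \in D).
exact: le_bigmax.
Qed.

Lemma iterE_exists k (phi : {set 'I_n} -> R) :
  exists D, iterE bernoulli_weight support k phi <= phi D.
Proof.
exists [arg max_(D > finset.set0) phi D]%O.
rewrite -[leRHS](iterE_cst support bernoulli_weight1 k).
apply: (iterE_le _ bernoulli_weight_ge0) => D.
by case: arg_maxP => // E _; apply.
Qed.

Lemma iterE_card_le k :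
  iterE bernoulli_weight support k (fun D => #|D|%:R) <= k%:R * (n%:R * beta).
Proof.
elim: k => [|k IH]; first by rewrite /= cards0 mul0r.
rewrite iterES; apply: (@le_trans _ _ (iterE bernoulli_weight support k
   (fun D => n%:R * beta + #|D|%:R))).
  apply: (iterE_le _ bernoulli_weight_ge0) => D.
  have -> : #|D|%:R = \sum_u bernoulli_weight u * #|D|%:R.
    by rewrite -mulr_suml bernoulli_weight1 mul1r.
  rewrite -sum_bernoulli_support -big_split /=.
  apply: ler_sum => u _; rewrite -mulrDr ler_wpM2l ?bernoulli_weight_ge0 //.
  by rewrite -natrD ler_nat leq_card_setU.
rewrite iterED (iterE_cst _ bernoulli_weight1) -[k.+1]add1n natrD mulrDl mul1r.
by rewrite lerD2l.
Qed.

Lemma undilute b r (p : nat -> 'I_n -> bool -> R) B F (e : R) :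
  (forall k, coord_dist (p k)) -> (0 < r)%N -> (0 < n)%N -> 0 < beta -> 0 < e ->
  1 - e <= value b r (fun k => dilute (p k)) B F ->
  exists2 D : {set 'I_n}, #|D|%:R <= 2 * (r%:R * (n%:R * beta)) &
    1 - 2 * e <= value b r p (B :|: D)%SET F.
Proof.
move=> pP r0 n0 b0 e0 h.
have m0 : 0 < r%:R * (n%:R * beta) by rewrite !mulr_gt0 // ltr0n.
pose l := e / (r%:R * (n%:R * beta)).
have l0 : 0 < l by rewrite divr_gt0.
have lm : l * (r%:R * (n%:R * beta)) = e by rewrite /l divfK // gt_eqF.
have lD : l * iterE bernoulli_weight support r (fun D => #|D|%:R) <= e.
  by rewrite -[leRHS]lm ler_wpM2l ?(ltW l0) ?iterE_card_le.
have [D] := iterE_exists r (fun D => value b r p (B :|: D)%SET F - l * #|D|%:R).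
rewrite iterEB iterEZ => hD.
have h1 := value_dilute_le b r B F pP.
have h2 := value_le1 b r (B :|: D)%SET F pP.
have c0 : 0 <= l * #|D|%:R by rewrite mulr_ge0 // ltW.
exists D; last by lra.
by rewrite -(ler_pM2l l0) mulrCA lm; lra.
Qed.

End Dilution.

(** * Optimal strategies *)

Section IteratedSum.
Variables (R : realType) (T : finType).

Fixpoint isum (r : nat) (ws : nat -> T -> R) (G : seq T -> R) : R :=
  if r is r'.+1 then
    \sum_a ws 0%N a * isum r' (fun k => ws k.+1) (fun s => G (a :: s))
  else G [::].

Lemma isumE r (ws : nat -> T -> R) G :
  \sum_(al : {ffun 'I_r -> T}) (\prod_(i < r) ws i (al i)) * G [seq al i | i <-
    enum 'I_r]
  = isum r ws G.
Proof.
elim: r ws G => [|r IH] ws G.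
  rewrite (big_pred1 (ffun0 (card_ord 0))); last first.
    by move=> al; apply/esym/eqP/ffunP=> -[].
  by rewrite big_ord0 mul1r (size0nil (size_enum_ord 0)).
pose h (ab : T * {ffun 'I_r -> T}) : {ffun 'I_r.+1 -> T} :=
  [ffun i => if unlift ord0 i is Some j then ab.2 j else ab.1].
pose h' (al : {ffun 'I_r.+1 -> T}) := (al ord0, [ffun j => al (lift ord0 j)]).
have hK : cancel h h'.
  case=> a be; rewrite /h /h' /= ffunE unlift_none; congr (_, _).
  by apply/ffunP=> j; rewrite !ffunE liftK.
have h'K : cancel h' h.
  move=> al; apply/ffunP=> i; rewrite ffunE /h' /=.
  by case: unliftP => [j ->|->]; rewrite ?ffunE.
rewrite (reindex h) /=; last by exists h' => ? _.
rewrite -(pair_big xpredT xpredT (fun a be => (\prod_(i < r.+1) ws i (h (a, be)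
  i)) *
  G [seq h (a, be) i | i <- enum 'I_r.+1])) /=.
apply: eq_bigr => a _; rewrite -IH mulr_sumr; apply: eq_bigr => be _.
rewrite big_ord_recl ffunE unlift_none -mulrA; congr (_ * (_ * _)).
  by apply: eq_bigr => i _; rewrite ffunE liftK.
rewrite enum_ordSl /= ffunE unlift_none -map_comp; congr (G (_ :: _)).
by apply: eq_map => i; rewrite /= ffunE liftK.
Qed.

End IteratedSum.

Section OptimalStrategy.
Variables (R : realType) (n r : nat) (b : bool) (B : {set 'I_n}).
Variables (mu : 'I_r -> cube 'I_n -> R) (p : nat -> 'I_n -> bool -> R).
Variable F : seq (cube 'I_n) -> bool.
Hypothesis pP : forall k, coord_dist (p k).
Hypothesis muE : forall i x, mu i x = \prod_j p i j (x j).
Implicit Types (pre : seq (cube 'I_n)) (a : good_bits B) (c : bad_bits B).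

Definition reply_value pre a c : R :=
  value b (r - (size pre).+1) (fun k => p ((size pre).+1 + k)) B
    (fun s => F (pre ++ glue a c :: s)).

Definition reply pre a : bad_bits B :=
  [arg max_(c > [ffun=> false]) reply_value pre a c]%O.

Definition play_from pre (s : seq (good_bits B)) :=
  foldl (fun t a => rcons t (glue a (reply t a))) pre s.

Definition play := play_from [::].

Lemma size_play s : size (play s) = size s.
Proof.
elim/last_ind: s => // s a IH.
by rewrite /play /play_from foldl_rcons size_rcons -/(play_from _ _) -/(play _)
  IH size_rcons.
Qed.

Lemma play_rcons s a : play (rcons s a) = rcons (play s) (glue a (reply (play
  s) a)).
Proof. by rewrite /play /play_from foldl_rcons. Qed.

Lemma nth_play x0 a0 s k : (k < size s)%N ->
  nth x0 (play s) k =
  glue (nth a0 s k) (reply (play (take k s)) (nth a0 s k)).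
Proof.
elim/last_ind: s => // s a IH; rewrite size_rcons ltnS => ks.
rewrite play_rcons !nth_rcons size_play -cats1 takel_cat //.
move: ks; rewrite leq_eqVlt => /orP[/eqP->|ks]; last by rewrite ks IH.
by rewrite ltnn eqxx take_size.
Qed.

Definition best_strategy : strategy r B := fun i h =>
  reply (play (take i [seq h j | j <- enum 'I_i.+1])) (h ord_max).

Lemma transcript_best x0 (al : {ffun 'I_r -> good_bits B}) (i : 'I_r) :
  transcript best_strategy al i = nth x0 (play [seq al i | i <- enum 'I_r]) i.
Proof.
pose a0 : good_bits B := [ffun=> false].
have si : (i < size [seq al i | i <- enum 'I_r])%N by rewrite size_map
  size_enum_ord.
rewrite (nth_play x0 a0 si) ffunE /best_strategy.
have -> : nth a0 [seq al i | i <- enum 'I_r] i = al i.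
  by rewrite (nth_map i) ?size_enum_ord // nth_ord_enum.
have -> : history al i ord_max = al i.
  by rewrite ffunE; congr (al _); apply: val_inj.
suff -> : take i [seq history al i j | j <- enum 'I_i.+1] =
    take i [seq al i | i <- enum 'I_r] by [].
apply: (@eq_from_nth _ a0) => [|k].
  by rewrite !size_take 2!size_map !size_enum_ord ltnSn ltn_ord.
rewrite size_take size_map size_enum_ord ltnSn => ki.
rewrite !nth_take // (nth_map ord0) ?size_enum_ord ?(ltn_trans ki) //.
rewrite (nth_map i) ?size_enum_ord ?(ltn_trans ki) // ffunE.
congr (al _); apply: val_inj => /=.
by rewrite !nth_enum_ord // ?(ltn_trans ki) // ltnS ltnW.
Qed.

Lemma mix_glue (x e : cube 'I_n) :
  exists c, mix B x e = glue (restrict_good B x) c.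
Proof.
exists [ffun i => e (\val i)]; apply/ffunP=> i; rewrite !ffunE.
by case: {-}_ / boolP => iB; rewrite ffunE /= ?iB ?(negPf iB) //.
Qed.

Definition good_weight (k : nat) a : R :=
  \sum_(x : cube 'I_n | restrict_good B x == a) \prod_j p k j (x j).

Lemma value_le_play r' pre : (size pre + r' = r)%N ->
  value b r' (fun k => p (size pre + k)) B (fun s => F (pre ++ s)) <=
  isum r' (fun k => good_weight (size pre + k))
    (fun s => (F (play_from pre s) == b)%:R).
Proof.
elim: r' pre => [|r' IH] pre pr /=; first by rewrite cats0.
rewrite addn0; pose best a := reply_value pre a (reply pre a).
apply: (@le_trans _ _ (\sum_a good_weight (size pre) a * best a)).
  rewrite /ex (partition_big (restrict_good B) xpredT) //=.
  apply: ler_sum => a _; rewrite /good_weight mulr_suml.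
  apply: ler_sum => x /eqP xa; apply: ler_wpM2l.
    by apply: prodr_ge0 => j _; apply: coord_dist_ge0.
  have best_ge c : reply_value pre a c <= best a.
    by rewrite /best /reply; case: arg_maxP => // d _; apply.
  have rE : (r - (size pre).+1 = r')%N by rewrite -pr addnS subSS addKn.
  have pE : (fun k => p (size pre + k.+1)) = (fun k => p ((size pre).+1 + k)).
    by apply/funext => k; rewrite addnS addSn.
  apply: bigmax_le => [|c _]; first by apply: value_ge0.
  have [d ->] := mix_glue x c; rewrite xa pE -{1}rE; exact: best_ge.
apply: ler_sum => a _; apply: ler_wpM2l.
  by apply: sumr_ge0 => x _; apply: prodr_ge0 => j _; apply: coord_dist_ge0.
have /IH : (size (rcons pre (glue a (reply pre a))) + r' = r)%N.
  by rewrite size_rcons addSnnS.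
rewrite /best /reply_value -pr addnS subSS addKn size_rcons.
under [X in value _ _ _ _ X]eq_fun => s do rewrite cat_rcons.
congr (_ <= isum _ _ _).
by apply/funext => k; rewrite addnS addSn.
Qed.

Lemma transcript_play (al : {ffun 'I_r -> good_bits B}) :
  [seq transcript best_strategy al i | i <- enum 'I_r] =
  play [seq al i | i <- enum 'I_r].
Proof.
pose x0 : cube 'I_n := [ffun=> false].
apply: (@eq_from_nth _ x0) => [|k]; first by rewrite size_play !size_map.
rewrite size_map size_enum_ord => kr.
pose i : 'I_r := Ordinal kr; rewrite -[k]/(nat_of_ord i).
by rewrite (nth_map i) ?size_enum_ord // nth_ord_enum (transcript_best x0).
Qed.

Lemma restrict_measureE (i : 'I_r) a : restrict_measure (mu i) a = good_weight
  i a.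
Proof. by apply: eq_bigr => x _; rewrite muE. Qed.

Lemma restrict_measure_ge0 (i : 'I_r) a : 0 <= restrict_measure (mu i) a.
Proof.
rewrite restrict_measureE; apply: sumr_ge0 => x _.
by apply: prodr_ge0 => j _; apply: coord_dist_ge0.
Qed.

Lemma value_le_influence (f : protocol n r) :
  (forall g, f g = F [seq g i | i <- enum 'I_r]) ->
  value b r p B F <= influence mu f b B.
Proof.
move=> fF; apply: (@le_trans _ _ (strategy_influence mu f b best_strategy)).
  have := @value_le_play r [::] (add0n _).
  move=> /le_trans; apply; rewrite -isumE /strategy_influence.
  rewrite [leRHS]big_mkcond; apply: ler_sum => al _.
  rewrite fF transcript_play; case: (F _ == b); last by rewrite mulr0.
  by rewrite mulr1; under eq_bigr => i _ do rewrite -restrict_measureE.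
apply: ub_le_sup; last by exists best_strategy.
exists (\sum_(al : {ffun 'I_r -> good_bits B}) \prod_i restrict_measure (mu i)
  (al i)).
move=> _ [strat _ <-]; rewrite /strategy_influence big_mkcond.
apply: ler_sum => al _; case: ifP => // _.
by apply: prodr_ge0 => i _; exact: restrict_measure_ge0.
Qed.

End OptimalStrategy.

(** * Growth of the success probabilities *)

Section Growth.
Variable R : realType.
Implicit Types (x y z u : R).

Definition exp2 x : R := expR (x * ln 2).

(* Beyond this point 400 z^5 <= 2^z. *)
Definition large : R := 2 ^+ 14.

Lemma ln2_bounds : 2^-1 <= ln 2 :> R /\ ln 2 <= 1 :> R.
Proof.
split; last by have := @ln_le_sub1 R 2 (ltr0n _ 2); lra.
have : ln (2^-1) <= 2^-1 - 1 :> R by apply: ln_le_sub1; lra.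
by rewrite lnV ?posrE //; lra.
Qed.

Lemma log2K x : 0 < x -> exp2 (log2 x) = x.
Proof.
move=> x0; rewrite /exp2 /log2 divfK ?lnK ?posrE //.
by case: ln2_bounds => h _; rewrite gt_eqF //; lra.
Qed.

Lemma ltW_large z : large <= z -> 2 <= z /\ 0 < z.
Proof.
move=> h; have : 2 <= large by rewrite /large exprS ler_peMr // exprn_ege1 //
  ler1n.
by split; lra.
Qed.

Lemma expR_ge_id x : x <= expR x.
Proof. by have := expR_ge1Dx x; lra. Qed.

Lemma exp2_poly z : large <= z -> 400 * z ^+ 5 <= exp2 z.
Proof.
move=> zl; have [z2 z0] := ltW_large zl; have [l1 l2] := ln2_bounds.
have h : z / 16 <= expR (z * ln 2 / 8).
  apply: le_trans (expR_ge_id _); have := ler_wpM2l (ltW z0) l1; lra.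
have -> : exp2 z = expR (z * ln 2 / 8) ^+ 8.
  by rewrite -expRM_natl /exp2; congr expR; rewrite -mulr_natl; field.
apply: (@le_trans _ _ ((z / 16) ^+ 8)); last first.
  by rewrite lerXn2r ?nnegrE ?expR_ge0 // divr_ge0 // ltW.
have z3 : large ^+ 3 <= z ^+ 3.
  by rewrite lerXn2r ?nnegrE /large ?exprn_ge0 // (ltW z0).
have -> : (z / 16) ^+ 8 = z ^+ 5 * (z ^+ 3 / 2 ^+ 32) by field.
rewrite mulrC ler_wpM2l ?exprn_ge0 ?(ltW z0) // ler_pdivlMr ?exprn_gt0 //.
apply: le_trans z3; rewrite /large -exprM -[(14 * 3)%N]/(10 + 32)%N exprD.
rewrite ler_wpM2r ?exprn_ge0 //; lra.
Qed.

Lemma double_exp_ge z : large <= z -> expR (200 * z ^+ 5) <= exp2 (exp2 z).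
Proof.
move=> zl; rewrite /exp2 -/(exp2 z) ler_expR; have [l1 l2] := ln2_bounds.
have h := exp2_poly zl; have e0 : 0 <= exp2 z by exact: expR_ge0.
by have := ler_wpM2l e0 l1; lra.
Qed.

Lemma exp2_ge_id z : large <= z -> z <= exp2 z.
Proof.
move=> zl; have [z2 z0] := ltW_large zl.
apply: le_trans (exp2_poly zl).
have : z <= z ^+ 5 by rewrite exprS ler_peMr ?(ltW z0) // exprn_ege1 //; lra.
have : 0 <= z ^+ 5 by rewrite exprn_ge0 // ltW.
lra.
Qed.

Lemma threshold_params (I y z e sg : R) : large <= y -> y <= z ->
  I <= 4 * y ^+ 2 -> (2 * y ^+ 2)^-1 <= e -> z^-1 <= sg ->
  exists t : R, [/\ 0 < t < 1, 0 < - ln t - ln 2,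
    3 * I < (- ln t - ln 2) * (e * (sg / 4)) &
    I / t ^+ 2 + 1 <= exp2 (exp2 z)].
Proof.
move=> yl yz Iy ey sz.
have zl := le_trans yl yz; have [z2 z0] := ltW_large zl.
have [y2 y0] := ltW_large yl; have [l1 l2] := ln2_bounds.
have Iz : I <= 4 * z ^+ 2.
  by apply: (le_trans Iy); rewrite ler_pM2l // lerXn2r ?nnegrE // ltW.
have z5 : 0 < z ^+ 5 by rewrite exprn_gt0.
pose L := ln 2 + 96 * z ^+ 5 + 1; have L0 : 0 < L by rewrite /L; lra.
exists (expR (- L)); rewrite expRK opprK.
have t0 : 0 < expR (- L) by exact: expR_gt0.
split.
- by rewrite t0 expR_lt1 oppr_lt0.
- by rewrite /L; lra.
- have q : (8 * z ^+ 3)^-1 <= e * (sg / 4).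
    have -> : (8 * z ^+ 3)^-1 = (2 * z ^+ 2)^-1 * (z^-1 / 4).
      by field; rewrite gt_eqF.
    have p1 : 0 <= (2 * z ^+ 2)^-1 by rewrite invr_ge0 mulr_ge0 ?exprn_ge0 //
      ltW.
    have p2 : 0 <= z^-1 / 4 by rewrite divr_ge0 // invr_ge0 ltW.
    apply: (ler_pM p1 p2).
      apply: le_trans ey; rewrite lef_pV2 ?posrE ?mulr_gt0 ?exprn_gt0 //.
      by rewrite ler_pM2l // lerXn2r ?nnegrE // ltW.
    by rewrite ler_pM2r ?invr_gt0.
  have L1 : 0 <= L - ln 2 by rewrite /L; lra.
  apply: lt_le_trans (ler_wpM2l L1 q).
  have -> : L - ln 2 = 96 * z ^+ 5 + 1 by rewrite /L; ring.
  rewrite ltr_pdivlMr ?mulr_gt0 ?exprn_gt0 //.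
  have : 3 * I * (8 * z ^+ 3) <= 3 * (4 * z ^+ 2) * (8 * z ^+ 3).
    by rewrite ler_wpM2r ?mulr_ge0 ?exprn_ge0 ?(ltW z0) // ler_pM2l.
  have -> : 3 * (4 * z ^+ 2) * (8 * z ^+ 3) = 96 * z ^+ 5 by ring.
  lra.
- apply: le_trans (double_exp_ge zl).
  have -> : I / expR (- L) ^+ 2 = I * expR (2 * L).
    by rewrite -expRM_natl -expRN; congr (_ * expR _); ring.
  have h1 : I * expR (2 * L) <= expR (4 * z ^+ 2) * expR (2 * L).
    by rewrite ler_wpM2r ?expR_ge0 // (le_trans Iz) // expR_ge_id.
  rewrite -expRD in h1.
  have h2 : 1 <= expR (4 * z ^+ 2 + 2 * L).
    apply: le_trans (expR_ge1Dx _); rewrite lerDl addr_ge0 ?mulr_ge0 ?exprn_ge0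
      ?(ltW z0) //.
    exact: ltW.
  have h3 : expR (4 * z ^+ 2 + 2 * L) * 2 <= expR (4 * z ^+ 2 + 2 * L) * expR 1.
    by rewrite ler_wpM2l ?expR_ge0 //; have := expR_ge1Dx (1 : R); lra.
  rewrite -expRD in h3.
  have h4 : expR (4 * z ^+ 2 + 2 * L + 1) <= expR (200 * z ^+ 5).
    rewrite ler_expR /L.
    have z22 : 4 <= z ^+ 2 by rewrite expr2; have := ler_pM (ler0n _ 2) (ler0n
      _ 2) z2 z2; lra.
    have z25 : 8 * z ^+ 2 <= z ^+ 5.
      rewrite (exprD z 3 2) ler_wpM2r ?exprn_ge0 ?(ltW z0) //.
      have -> : 8 = 2 ^+ 3 :> R by ring.
      by rewrite lerXn2r ?nnegrE ?(ltW z0).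
    lra.
  lra.
Qed.

Lemma success_prob_ge (n k m : nat) (y z u sg : R) : large <= y -> y <= z ->
  z <= u -> z^-1 <= sg -> (0 < k <= n)%N -> n%:R / k%:R <= y ->
  (0 < m)%N -> m%:R <= u -> (m <= k)%N ->
  (exp2 (exp2 u))^-1 <=
    sg / 4 * (1 / 2 * ((k %/ m)%:R / (2 * n)%:R) ^+ m).
Proof.
move=> yl yz zu sz /andP[k0 kn] nky m0 mu mk.
have zl := le_trans yl yz; have [z2 z0] := ltW_large zl.
have ul := le_trans zl zu; have [u2 u0] := ltW_large ul.
have [y2 y0] := ltW_large yl.
have n0 : (0 < n)%N by exact: leq_trans k0 kn.
have nR : 0 < n%:R :> R by rewrite ltr0n.
have kR : 0 < k%:R :> R by rewrite ltr0n.
have mR : 0 < m%:R :> R by rewrite ltr0n.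
have ql : (4 * u ^+ 2)^-1 <= (k %/ m)%:R / (2 * n)%:R.
  have h1 : k%:R <= 2 * m%:R * (k %/ m)%:R :> R.
    rewrite -!natrM ler_nat {1}(divn_eq k m) mulnC -mulnA mul2n -addnn leq_add
      //.
    by rewrite ltnW // (leq_trans (ltn_pmod k m0)) // leq_pmulr // divn_gt0.
  have h2 : n%:R <= y * k%:R by rewrite -ler_pdivrMr.
  rewrite ler_pdivlMr ?ltr0n ?muln_gt0 ?n0 // natrM mulrC ler_pdivrMr ?mulr_gt0
    ?exprn_gt0 //.
  have h3 : y * k%:R <= u * (2 * m%:R * (k %/ m)%:R).
    by apply: ler_pM => //; [exact: ltW|exact: le_trans yz zu].
  have h4 : u * (2 * m%:R * (k %/ m)%:R) <= u * (2 * u * (k %/ m)%:R).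
    by rewrite ler_pM2l // ler_wpM2r // ler_pM2l.
  have e : (k %/ m)%:R * (4 * u ^+ 2) = 2 * (u * (2 * u * (k %/ m)%:R)) :> R by
    ring.
  rewrite e; lra.
have [l1 l2] := ln2_bounds.
have pm : expR (- (4 * u ^+ 3)) <= ((k %/ m)%:R / (2 * n)%:R) ^+ m.
  have q0 : 0 < (4 * u ^+ 2)^-1 by rewrite invr_gt0 mulr_gt0 ?exprn_gt0.
  apply: (@le_trans _ _ ((4 * u ^+ 2)^-1 ^+ m)); last first.
    by rewrite lerXn2r ?nnegrE ?(ltW q0) // (le_trans (ltW q0)).
  rewrite exprVn expRN lef_pV2 ?posrE ?expR_gt0 ?exprn_gt0 ?mulr_gt0 ?exprn_gt0
    //.
  apply: (@le_trans _ _ (expR (4 * u ^+ 2) ^+ m)).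
    by rewrite lerXn2r ?nnegrE ?expR_ge0 ?mulr_ge0 ?exprn_ge0 ?(ltW u0)
      ?expR_ge_id.
  rewrite -expRM_natl ler_expR (_ : 4 * u ^+ 3 = u * (4 * u ^+ 2)); last by
    ring.
  by rewrite ler_wpM2r ?mulr_ge0 ?exprn_ge0 ?(ltW u0).
apply: (@le_trans _ _ (u^-1 / 4 * (1 / 2 * expR (- (4 * u ^+ 3))))); last first.
  have p1 : 0 <= u^-1 / 4 by rewrite divr_ge0 // invr_ge0 ltW.
  have p2 : 0 <= 1 / 2 * expR (- (4 * u ^+ 3)) by rewrite mulr_ge0 ?divr_ge0
    ?expR_ge0.
  apply: (ler_pM p1 p2).
    rewrite ler_pM2r ?invr_gt0 //; apply: le_trans sz.
    by rewrite lef_pV2 ?posrE.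
  by rewrite ler_pM2l ?divr_gt0.
have -> : u^-1 / 4 * (1 / 2 * expR (- (4 * u ^+ 3))) = (8 * u * expR (4 * u ^+
  3))^-1.
  rewrite expRN; field; rewrite !gt_eqF ?expR_gt0 //.
rewrite lef_pV2 ?posrE ?expR_gt0 ?mulr_gt0 ?expR_gt0 //.
apply: le_trans (double_exp_ge ul).
apply: (@le_trans _ _ (expR (8 * u) * expR (4 * u ^+ 3))).
  by rewrite ler_wpM2r ?expR_ge0 ?expR_ge_id.
rewrite -expRD ler_expR.
have u5 : u <= u ^+ 5 by rewrite exprS ler_peMr ?(ltW u0) // exprn_ege1 //; lra.
have u35 : u ^+ 3 <= u ^+ 5.
  by rewrite (exprD u 3 2) ler_peMr ?exprn_ge0 ?(ltW u0) // exprn_ege1 //; lra.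
lra.
Qed.

End Growth.

Section Rounds.
Variables (R : realType).

Lemma iter_exp2_ilog k (x : R) : ilog_defined k x -> iter k (@exp2 R) (ilog k
  x) = x.
Proof.
elim: k => [//|k IH] def.
rewrite iterSr [ilog _ _]/= -/(ilog k x) log2K; last exact: def.
by apply: IH => j jk; apply: def; apply: ltnW.
Qed.

Lemma iter_exp2_large k (z : R) : large R <= z ->
  large R <= iter k (@exp2 R) z /\ z <= iter k (@exp2 R) z.
Proof.
move=> zl; elim: k => [//|k [IH1 IH2]] /=; have h := exp2_ge_id IH1.
by split; [apply: le_trans h|apply: le_trans h].
Qed.

Lemma iter_exp2_le j k (z : R) : large R <= z -> (j <= k)%N ->
  iter j (@exp2 R) z <= iter k (@exp2 R) z.
Proof.
move=> zl jk; rewrite -(subnK jk) iterD.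
exact: (iter_exp2_large _ (iter_exp2_large _ zl).1).2.
Qed.

Lemma truncn_junta_size (n k : nat) (y u : R) : large R <= y -> y <= u ->
  (0 < k)%N -> n%:R / k%:R <= y -> exp2 (exp2 u) <= n%:R ->
  (Num.truncn u <= k)%N.
Proof.
move=> yl yu k0 nky un; have ul := le_trans yl yu.
have [u2 u0] := ltW_large ul; have kR : 0 < k%:R :> R by rewrite ltr0n.
rewrite -(ler_nat R); apply: (@le_trans _ _ u).
  by rewrite Num.Theory.truncn_le ltW.
have h1 : n%:R <= y * k%:R by rewrite -ler_pdivrMr.
have h2 : y * k%:R <= u * k%:R by rewrite ler_pM2r.
rewrite -(ler_pM2l u0); apply: le_trans h2; apply: le_trans h1.
apply: le_trans un; apply: le_trans (double_exp_ge ul).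
apply: le_trans (expR_ge_id _).
have : u * u <= u ^+ 5.
  by rewrite (exprD u 2 3) expr2 ler_peMr ?mulr_ge0 ?(ltW u0) // exprn_ege1 //;
    lra.
have : 0 <= u ^+ 5 by rewrite exprn_ge0 // ltW.
lra.
Qed.

Lemma rounds (n r k : nat) (y e : R) : large R <= y ->
  iter (4 * r) (@exp2 R) y <= n%:R -> (0 < k <= n)%N -> n%:R / k%:R <= y ->
  0 <= e -> (2 * y ^+ 2)^-1 <= e -> r%:R * e <= 1 ->
  forall j, (j <= r)%N -> forall p : nat -> 'I_n -> bool -> R,
  (forall i, coord_dist (p i)) -> (forall i a c, (2 * y)^-1 <= p i a c) ->
  forall F, (iter (4 * j) (@exp2 R) y)^-1 <=
    sampleE (j * (k + k)) (fun B => (controls (j%:R * e) j p F B)%:R) :> R.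
Proof.
move=> yl towern k0n nky e0 ey re1; have /andP[k0 kn] := k0n.
have n0 : (0 < n)%N by exact: leq_trans k0 kn.
have [y2 y0] := ltW_large yl.
elim=> [|j IH] jr p pP pt F.
  rewrite /sampleE /= /controls /= mul0r subr0.
  case: (F [::]) => /=; rewrite lexx ?orbT /= invf_le1 //; lra.
set z := iter (4 * j) (@exp2 R) y.
have [zl yz] : large R <= z /\ y <= z := iter_exp2_large _ yl.
pose u := exp2 (exp2 z).
have towerS : iter (4 * j.+1) (@exp2 R) y = exp2 (exp2 u) by rewrite mulnS.
have zu : z <= u by apply: le_trans (exp2_ge_id _); rewrite ?exp2_ge_id //
  (le_trans zl) // exp2_ge_id.
have un : exp2 (exp2 u) <= n%:R.
  by rewrite -towerS; apply: le_trans towern; apply: iter_exp2_le => //;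
    rewrite leq_mul2l.
have [z2 z0] := ltW_large zl; have [u2 u0] := ltW_large (le_trans zl zu).
pose tau := (2 * y)^-1.
have tau0 : 0 < tau by rewrite invr_gt0 mulr_gt0.
pose I := 2 * (n%:R / k%:R) / tau.
have Iy : I <= 4 * y ^+ 2.
  rewrite /I /tau invrK (_ : 4 * y ^+ 2 = 2 * y * (2 * y)); last by ring.
  by rewrite ler_pM2r ?mulr_gt0 // ler_pM2l.
have [t [t01 L0 bI bt]] := threshold_params yl yz Iy ey (lexx z^-1).
pose m := Num.truncn u.
have mu : m%:R <= u by rewrite Num.Theory.truncn_le ltW.
have m0 : (0 < m)%N by rewrite Num.Theory.truncn_gt0; lra.
have mk : (m <= k)%N := truncn_junta_size yl (le_trans yz zu) k0 nky un.
have bm : I <= m%:R * t ^+ 2.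
  have /andP[t0 _] := t01.
  rewrite -ler_pdivrMr ?exprn_gt0 //.
  have := Num.Theory.truncnS_gt u; rewrite -/m -natr1 -/u in bt *; lra.
have sp := success_prob_ge yl yz zu (lexx z^-1) k0n nky m0 mu mk.
rewrite towerS; apply: (le_trans sp).
have -> : j.+1%:R * e = e + j%:R * e by rewrite -natr1; ring.
rewrite [X in sampleE X](_ : _ = j * (k + k) + (k + k))%N; last by rewrite
  mulSn addnC.
have zi0 : 0 <= z^-1 by rewrite invr_ge0 ltW.
apply: controls_step => //.
- rewrite mulr_ge0 //=; apply: le_trans re1.
  by rewrite ler_wpM2r // ler_nat ltnW.
- by rewrite mulr_ge0 ?divr_ge0 // exprn_ge0 // divr_ge0.
- exact: IH (ltnW jr) (fun i => p i.+1) (fun i => pP i.+1) (fun i => pt i.+1).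
move=> A dA; apply: (boost n0 (pP 0%N) e0 tau0 _ k0 t01 L0 bI bm) => //.
- by rewrite mulnC leq_trunc_div.
- by apply: leq_trans kn; exact: leq_div.
Qed.

Lemma sampleE_exists (n N : nat) (P : pred {set 'I_n}) : (0 < n)%N ->
  0 < sampleE N (fun B => (P B)%:R) :> R -> exists2 B : {set 'I_n}, (#|B| <=
    N)%N & P B.
Proof.
move=> n0 h; apply: contrapT => /forall2NP na.
suff : sampleE N (fun B => (P B)%:R) <= sampleE N (fun _ : {set 'I_n} => 0) :>
  R.
  move=> /(lt_le_trans h).
  by rewrite /sampleE (iterE_cst _ (sample_weight1 R n0)) ltxx.
apply: (iterE_le_card (@sample_weight_ge0 R n)) => [j|D DN].
  by rewrite cards1.
by case: (na D) => // /negP /negPf ->.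
Qed.

Lemma coord_prob_dist (n : nat) (mu : cube 'I_n -> R) :
  is_probability mu -> coord_dist (coord_prob mu).
Proof.
move=> [mu0 mu1] i; split=> [c|]; first by apply: sumr_ge0.
rewrite /coord_prob -mu1 [RHS](bigID (fun x : cube 'I_n => x i == true)) /=.
by congr (_ + _); apply: eq_bigl => x; case: (x i).
Qed.

Lemma value_setT (n r : nat) (p : nat -> 'I_n -> bool -> R) F (x0 : cube 'I_n) :
  (forall k, coord_dist (p k)) ->
  1 <= value (F (nseq r x0)) r p finset.setT F.
Proof.
move=> pP; elim: r p F pP => [|r IH] p F pP; first by rewrite /= eqxx.
rewrite [value _ _ _ _ _]/= -[leLHS](ex_cst (pP 0%N)); apply: ex_le => // x.
apply: (le_trans (IH (fun k => p k.+1) (fun s => F (x0 :: s)) _)) => //.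
have {3}-> : x0 = mix finset.setT x x0 by apply/ffunP=> i; rewrite ffunE inE.
exact: le_bigmax.
Qed.

End Rounds.

Lemma value_le_influence_product (R : realType) (n r : nat)
    (mu : 'I_r.+1 -> cube 'I_n -> R) (f : protocol n r.+1) b B :
  (forall i, is_product_probability (mu i)) ->
  value b r.+1 (fun k => coord_prob (mu (inord k))) B
    (fun s => f [ffun i : 'I_r.+1 => nth [ffun=> false] s i])
  <= influence mu f b B.
Proof.
move=> muP; apply: value_le_influence => [k|i x|g].
- exact: coord_prob_dist (muP _).1.
- by rewrite inord_val (muP i).2.
- congr f; apply/ffunP=> i; rewrite ffunE.
  by rewrite (nth_map i) ?size_enum_ord // nth_ord_enum.
Qed.

Lemma exists_influential_setT (R : realType) (n r : nat)
    (mu : 'I_r.+1 -> cube 'I_n -> R) (f : protocol n r.+1) :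
  (forall i, is_product_probability (mu i)) ->
  exists b, 1 <= influence mu f b finset.setT.
Proof.
move=> muP; set F := fun s => f [ffun i : 'I_r.+1 => nth [ffun=> false] s i].
exists (F (nseq r.+1 [ffun=> false])).
apply: le_trans (value_le_influence_product _ _ _ muP).
by apply: value_setT => k; exact: coord_prob_dist (muP _).1.
Qed.

Lemma logstar_gt (R : realType) k (x : R) :
  (forall j, (j <= k)%N -> 1 < ilog j x) -> (k < logstar x)%N.
Proof.
move=> h; rewrite /logstar; case: ex_minnP => m hm _.
by rewrite ltnNge; apply/negP => /h; rewrite ltNge hm.
Qed.

Lemma exists_controlling_coalition (R : realType) (eps y : R) (n r : nat)
    (mu : 'I_r.+1 -> cube 'I_n -> R) (f : protocol n r.+1) :
  large R <= y -> 0 < eps < 1 -> eps^-1 <= y -> r.+1%:R <= y ->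
  iter (4 * r.+1) (@exp2 R) y = n%:R ->
  (forall i, is_product_probability (mu i)) ->
  exists (B : {set 'I_n}) (b : bool),
    #|B|%:R <= 6 * r.+1%:R * (n%:R / y) /\ 1 - eps <= influence mu f b B.
Proof.
move=> yl /andP[eps0 eps1] epsy ry tower muP.
have [y2 y0] := ltW_large yl.
have yn : y <= n%:R by rewrite -tower; exact: (iter_exp2_large _ yl).2.
have nR : 0 < n%:R :> R by apply: lt_le_trans yn.
have n0 : (0 < n)%N by rewrite -(ltr0n R).
have rR : 0 < r.+1%:R :> R by rewrite ltr0n.
have ny1 : 1 <= n%:R / y by rewrite ler_pdivlMr // mul1r.
pose k := (Num.truncn (n%:R / y)).+1.
have k1 : n%:R / y < k%:R by exact: Num.Theory.truncnS_gt.
have k2 : k%:R <= 2 * (n%:R / y).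
  have : (Num.truncn (n%:R / y))%:R <= n%:R / y by rewrite
    Num.Theory.truncn_le; lra.
  rewrite /k -natr1; lra.
have kn : (k <= n)%N.
  rewrite -(ler_nat R); apply: (le_trans k2).
  by rewrite mulrA ler_pdivrMr // mulrC ler_pM2l.
have nky : n%:R / k%:R <= y.
  by rewrite ler_pdivrMr ?ltr0n // mulrC -ler_pdivrMr // ltW.
pose e := eps / (2 * r.+1%:R).
have e0 : 0 <= e by rewrite divr_ge0 ?mulr_ge0 // ltW.
have re : r.+1%:R * e = eps / 2.
  by rewrite /e; move: (r.+1%:R : R) rR => q q0; field; rewrite gt_eqF.
have ye : (2 * y ^+ 2)^-1 <= e.
  rewrite -[leLHS]mul1r ler_pdivrMr ?mulr_gt0 ?exprn_gt0 // /e mulrAC.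
  rewrite ler_pdivlMr ?mulr_gt0 // mul1r.
  have h : 1 <= eps * y by rewrite mulrC -ler_pdivrMr // div1r.
  have : y * 1 <= y * (eps * y) by rewrite ler_pM2l.
  by rewrite (_ : eps * (2 * y ^+ 2) = 2 * (y * (eps * y))); [lra|ring].
pose beta := y^-1.
have b0 : 0 < beta by rewrite invr_gt0.
have b01 : 0 <= beta <= 1 by rewrite ltW //= invf_le1 //; lra.
pose p j := coord_prob (mu (inord j : 'I_r.+1)).
have pP j : coord_dist (p j) by exact: coord_prob_dist (muP _).1.
pose F s := f [ffun i : 'I_r.+1 => nth [ffun=> false] s i].
have k0n : (0 < k <= n)%N by [].
have towern : iter (4 * r.+1) (@exp2 R) y <= n%:R by rewrite tower.
have re1 : r.+1%:R * e <= 1 by rewrite re; lra.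
have := rounds yl towern k0n nky e0 ye re1 (leqnn _)
  (fun j => dilute_dist b01 (pP j)) _ F.
have bt i a c : (2 * y)^-1 <= dilute beta (p i) a c.
  by apply: le_trans (dilute_ge b01 _ _ (pP i)); rewrite /beta invfM mulrC.
move=> /(_ bt) h.
have [B cB ctl] : exists2 B : {set 'I_n}, (#|B| <= r.+1 * (k + k))%N &
    controls (r.+1%:R * e) r.+1 (fun j => dilute beta (p j)) F B.
  apply: (sampleE_exists (R := R)) => //; apply: lt_le_trans h.
  by rewrite tower invr_gt0.
have [b hb] : exists b,
    1 - eps / 2 <= value b r.+1 (fun j => dilute beta (p j)) B F.
  by rewrite -re; case/orP: ctl => ctl; [exists true|exists false].
have eps20 : 0 < eps / 2 by lra.
have [D cD hD] := undilute b01 pP (ltn0Sn r) n0 b0 eps20 hb.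
exists (B :|: D)%SET, b; split; last first.
  apply: le_trans (value_le_influence_product _ _ _ muP).
  by apply: le_trans hD; lra.
have c1 : #|(B :|: D)%SET|%:R <= (r.+1 * (k + k))%:R + #|D|%:R :> R.
  by rewrite -natrD ler_nat (leq_trans (leq_card_setU _ _)) // leq_add2r.
have c2 : (r.+1 * (k + k))%:R <= r.+1%:R * (4 * (n%:R / y)) :> R.
  by rewrite natrM natrD ler_pM2l //; lra.
rewrite /beta in cD; lra.
Qed.

Theorem theorem2 (R : realType) (eps : R) (heps : 0 < eps < 1) :
  exists (C : R) (N : nat), 0 < C /\
    forall n r : nat,
      (N <= n)%N -> (0 < r)%N -> (r < n)%N ->
      ilog_defined (4 * r) (n%:R : R) -> 0 < ilog (4 * r) (n%:R : R) ->
      forall mu : 'I_r -> cube 'I_n -> R,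
        (forall i : 'I_r, is_product_probability (mu i)) ->
        forall f : protocol n r,
          exists (B : {set 'I_n}) (b : bool),
            (#|B|%:R <= C * (n%:R * (logstar (n%:R : R))%:R ^+ 2
                             / ilog (4 * r) (n%:R : R)))
            /\ 1 - eps <= influence mu f b B.
Proof.
have /andP[eps0 eps1] := heps.
have l2 : 2 <= large R := (ltW_large (lexx _)).1.
have ei : 0 < eps^-1 by rewrite invr_gt0.
exists (6 + large R + eps^-1), 2%N; split; first by lra.
move=> n [//|r] n2 _ _ def y0 mu muP f.
set C := 6 + _ + _; set y := ilog _ _ in y0 *; set ls := logstar _.
have C6 : 6 <= C by rewrite /C; lra.
have [yC|Cy] := leP y (C * ls%:R ^+ 2).
  have [b hb] := exists_influential_setT f muP.
  exists finset.setT, b; split; last by apply: le_trans hb; lra.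
  by rewrite cardsT card_ord mulrA ler_pdivlMr // [leRHS]mulrCA ler_wpM2l.
have ls1 : (0 < ls)%N.
  by apply: logstar_gt => j; rewrite leqn0 => /eqP ->; rewrite /= ltr1n.
have lsR : 1 <= ls%:R :> R by rewrite ler1n.
have lsq : ls%:R <= ls%:R ^+ 2 :> R by rewrite expr2 ler_peMl // ler0n.
have Cls : C * ls%:R <= C * ls%:R ^+ 2 by rewrite ler_wpM2l //; lra.
have C1 : C * 1 <= C * ls%:R by rewrite ler_wpM2l //; lra.
have Cy1 : C <= y by rewrite -[C]mulr1; apply: le_trans C1 (le_trans Cls (ltW
  Cy)).
have yl : large R <= y by apply: le_trans Cy1; rewrite /C; lra.
have rls : (4 * r.+1 < ls)%N.
  apply: logstar_gt => j j4.
  have e : iter (4 * r.+1 - j) (@exp2 R) y = ilog j n%:R.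
    have -> : y = ilog (4 * r.+1 - j) (ilog j (n%:R : R)).
      by rewrite /ilog -iterD subnK.
    apply: iter_exp2_ilog => i ij; rewrite /ilog -iterD -/(ilog _ _); apply:
      def.
    by rewrite -(subnK j4) ltn_add2r.
  have := (iter_exp2_large (4 * r.+1 - j) yl).1; rewrite e; lra.
have rlsR : r.+1%:R <= ls%:R :> R.
  by rewrite ler_nat (leq_trans _ (ltnW rls)) // leq_pmull.
have C1ls : 6 * ls%:R <= C * ls%:R by rewrite ler_wpM2r // (le_trans ler01).
have epsy : eps^-1 <= y by apply: le_trans Cy1; rewrite /C; lra.
have ry : r.+1%:R <= y.
  apply: (le_trans rlsR); apply: le_trans (le_trans Cls (ltW Cy)).
  by rewrite ler_peMl //; lra.
have [B [b [cB hB]]] :=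
  exists_controlling_coalition f yl heps epsy ry (iter_exp2_ilog def) muP.
exists B, b; split=> //; apply: (le_trans cB).
rewrite [_ * (n%:R * _ / _)](_ : _ = C * ls%:R ^+ 2 * (n%:R / y)); last by ring.
apply: ler_wpM2r; first exact: (divr_ge0 (ler0n _ _) (ltW y0)).
by apply: le_trans (le_trans C1ls Cls); rewrite ler_pM2l.
Qed.
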